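(* Fix positive integers $p\ge2$, $q$, and a vector $\boldsymbol{\alpha}\in\mathbb{R}^q$. Consider a sequence, indexed by $n\to\infty$, of multivariate allometric regression models as described in the context, with $\boldsymbol{X}=\boldsymbol{X}_n$ and $\boldsymbol{\Sigma}=\boldsymbol{\Sigma}_n$ depending on $n$, such that (i) $n^{-1}\boldsymbol{X}'\boldsymbol{X}$ converges to a finite positive-definite matrix; (ii) $\mathrm{tr}(\boldsymbol{\Sigma})=\Theta(1)$, $\mathrm{tr}(\boldsymbol{\Sigma}^2)=\Theta(1)$, and $\lambda_1-\lambda_2=\Theta(n^{-\eta})$ for some $\eta>0$. Let $w^*$ (depending on $n$) be the weight defined in the context. If $\boldsymbol{\alpha}\neq\boldsymbol{0}_q$ or $\eta<1/2$, then, as $n\to\infty$, \[ \min_{\theta\in\{-1,1\}} \| \theta\hat{\boldsymbol{\gamma}}_1(w^* )-\boldsymbol{\gamma}_1\| \to 0 \quad\text{in probability}. \]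
   Context: Model (for each $n$). Let $n,p,q$ be positive integers with $p\ge 2$ and $n>1+q$. Let $\boldsymbol{X}$ be a deterministic real $n\times q$ matrix with $\mathrm{rank}(\boldsymbol{X})=q$ and $\boldsymbol{X}'\boldsymbol{1}_n=\boldsymbol{0}_q$ (here $'$ is transpose and $\boldsymbol{1}_n$ is the all-ones vector), $\boldsymbol{\mu}\in\mathbb{R}^p$, $\boldsymbol{\alpha}\in\mathbb{R}^q$. Let $\boldsymbol{\Sigma}$ be a $p\times p$ positive-definite matrix with eigenvalues $\lambda_1>\lambda_2\ge\cdots\ge\lambda_p>0$, and let $\boldsymbol{\gamma}_1$ be a unit eigenvector of $\boldsymbol{\Sigma}$ for $\lambda_1$ (all of these may depend on $n$ unless said to be fixed). The observed $n\times p$ matrix is \[ \boldsymbol{Y} = \boldsymbol{1}_n\boldsymbol{\mu}' + \boldsymbol{X}\boldsymbol{\alpha}\boldsymbol{\gamma}_1' + \boldsymbol{E},\qquad \mathrm{vec}(\boldsymbol{E})\sim \mathcal{N}_{np}(\boldsymbol{0}_{np},\boldsymbol{\Sigma}\otimes \boldsymbol{I}_n), \] i.e. the rows of $\boldsymbol{E}$ are i.i.d. $\mathcal{N}_p(\boldsymbol{0}_p,\boldsymbol{\Sigma})$. Estimators. Let \[ \boldsymbol{S}_R = \boldsymbol{Y}'\boldsymbol{X}(\boldsymbol{X}'\boldsymbol{X})^{-1}\boldsymbol{X}'\boldsymbol{Y},\qquad \boldsymbol{S}_E = \boldsymbol{Y}'\Bigl\{ \boldsymbol{I}_n - \tfrac1n\boldsymbol{1}_n\boldsymbol{1}_n'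 - \boldsymbol{X}(\boldsymbol{X}'\boldsymbol{X})^{-1}\boldsymbol{X}' \Bigr\}\boldsymbol{Y}, \] and $\boldsymbol{S}(w) = (1-w)\boldsymbol{S}_R + w\boldsymbol{S}_E$ for $0\le w\le 1$. The estimator $\hat{\boldsymbol{\gamma}}_1(w)$ is the first principal eigenvector of $\boldsymbol{S}(w)$, i.e. a unit eigenvector of $\boldsymbol{S}(w)$ corresponding to its largest eigenvalue. $\|\cdot\|$ is the Euclidean norm. Weight. With $a = \mathrm{tr}(\boldsymbol{\Sigma}^2) + (\mathrm{tr}(\boldsymbol{\Sigma}))^2$, $b = \lambda_1 + \mathrm{tr}(\boldsymbol{\Sigma})$, $c = \| \boldsymbol{X}\boldsymbol{\alpha} \|^2$, $d = \lambda_1-\lambda_2$, \[ w^* = \frac{adq+2bcd}{2adq+2bcd+ac}\in[0,1]. \] Notation. For a sequence $(a_n)$, $a_n=\Theta(n^u)$ means $\liminf_{n\to\infty}(a_n/n^u)>0$ and $\limsup_{n\to\infty}(a_n/n^u)<\infty$. *)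

(* Defs.v *)
From HB Require Import structures.
From mathcomp Require Import all_boot all_order all_algebra.
From mathcomp Require Import all_classical all_reals all_analysis.
From mathcomp.real_closed Require Import mxtens.

Set Implicit Arguments.
Unset Strict Implicit.
Unset Printing Implicit Defensive.

Import Order.TTheory GRing.Theory Num.Theory.
Import numFieldNormedType.Exports.

Local Open Scope classical_set_scope.
Local Open Scope ring_scope.

(* The library norm on matrices is the sup norm, hence a separate definition. *)
Definition enorm (R : realType) (m : nat) (v : 'cV[R]_m) : R :=
  Num.sqrt (\sum_(i < m) v i 0 ^+ 2).

Definition posdef (R : realType) (m : nat) (A : 'M[R]_m) : Prop :=
  A^T = A /\ forall v : 'cV[R]_m, v != 0 -> 0 < (v^T *m A *m v) 0 0.

(* lam 1 >= ... >= lam m are the eigenvalues of A, with multiplicity; the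
   values of lam outside 1..m are irrelevant. *)
Definition ordered_eigenvalues (R : realType) (m : nat) (A : 'M[R]_m)
    (lam : nat -> R) : Prop :=
  char_poly A = \prod_(1 <= i < m.+1) ('X - (lam i)%:P) /\
  forall i, (1 <= i < m)%N -> lam i.+1 <= lam i.

Definition unit_eigenvector (R : realType) (m : nat) (A : 'M[R]_m) (l : R)
    (v : 'cV[R]_m) : Prop :=
  A *m v = l *: v /\ enorm v = 1.

Definition first_principal_eigenvector (R : realType) (m : nat) (A : 'M[R]_m)
    (v : 'cV[R]_m) : Prop :=
  exists2 l, unit_eigenvector A l v & forall k, eigenvalue A k -> k <= l.

(* Univariate N(m, v), where v is the variance. The library's normal_prob takes
   the standard deviation and is not a Dirac mass when the latter is 0. *)
Definition normal_law (R : realType) (m v : R) (B : set R) : \bar R :=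
  if v == 0 then \d_m B else normal_prob m (Num.sqrt v) B.

(* Z ~ N_k(m, V): every linear combination t'Z is a random variable with law
   N(t'm, t'Vt). *)
Definition multivariate_normal (R : realType) (d : measure_display)
    (T : measurableType d) (P : probability T R) (k : nat) (Z : T -> 'cV[R]_k)
    (m : 'cV[R]_k) (V : 'M[R]_k) : Prop :=
  forall t : 'cV[R]_k,
    let tZ := fun w => (t^T *m Z w) 0 0 in
    measurable_fun [set: T] tZ /\
    forall B : set R, measurable B ->
      P (tZ @^-1` B) = normal_law ((t^T *m m) 0 0) ((t^T *m V *m t) 0 0) B.

(* Column stacking: entry (i, j) of E has index j * n + i, the indexing of the
   Kronecker product tensmx. *)
Definition vec (R : realType) (n p : nat) (E : 'M[R]_(n, p)) : 'cV[R]_(p * n) :=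
  \col_k E (mxtens_unindex k).2 (mxtens_unindex k).1.

Definition ones (R : realType) (n : nat) : 'cV[R]_n := const_mx 1.

Definition allometric_obs (R : realType) (n p q : nat) (X : 'M[R]_(n, q))
    (mu : 'cV[R]_p) (alpha : 'cV[R]_q) (gamma1 : 'cV[R]_p) (E : 'M[R]_(n, p)) :
    'M[R]_(n, p) :=
  ones R n *m mu^T + X *m alpha *m gamma1^T + E.

Record allometric_model (R : realType) (d : measure_display)
    (T : measurableType d) (P : probability T R) (n p q : nat)
    (X : 'M[R]_(n, q)) (Sigma : 'M[R]_p) (lam : nat -> R) (gamma1 : 'cV[R]_p)
    (E : T -> 'M[R]_(n, p)) : Prop := AllometricModel {
  am_rank : \rank X = q;
  am_centered : X^T *m ones R n = 0;
  am_posdef : posdef Sigma;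
  am_eigenvalues : ordered_eigenvalues Sigma lam;
  am_gap : lam 2%N < lam 1%N;
  am_pos : 0 < lam p;
  am_gamma1 : unit_eigenvector Sigma (lam 1%N) gamma1;
  am_error : multivariate_normal P (fun w => vec (E w)) 0 (tensmx Sigma 1%:M)
}.

Definition hat_mx (R : realType) (n q : nat) (X : 'M[R]_(n, q)) : 'M[R]_n :=
  X *m invmx (X^T *m X) *m X^T.

Definition S_R (R : realType) (n p q : nat) (X : 'M[R]_(n, q))
    (Y : 'M[R]_(n, p)) : 'M[R]_p :=
  Y^T *m hat_mx X *m Y.

Definition S_E (R : realType) (n p q : nat) (X : 'M[R]_(n, q))
    (Y : 'M[R]_(n, p)) : 'M[R]_p :=
  Y^T *m (1%:M - n%:R^-1 *: (ones R n *m (ones R n)^T) - hat_mx X) *m Y.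

Definition S_w (R : realType) (n p q : nat) (X : 'M[R]_(n, q))
    (Y : 'M[R]_(n, p)) (w : R) : 'M[R]_p :=
  (1 - w) *: S_R X Y + w *: S_E X Y.

Definition w_star (R : realType) (n p q : nat) (X : 'M[R]_(n, q))
    (alpha : 'cV[R]_q) (Sigma : 'M[R]_p) (lam : nat -> R) : R :=
  let a := \tr (Sigma *m Sigma) + (\tr Sigma) ^+ 2 in
  let b := lam 1%N + \tr Sigma in
  let c := enorm (X *m alpha) ^+ 2 in
  let d := lam 1%N - lam 2%N in
  (a * d * q%:R + 2 * b * c * d) / (2 * a * d * q%:R + 2 * b * c * d + a * c).

(* a_n = Theta(n^u) *)
Definition Theta_pow (R : realType) (a : nat -> R) (u : R) : Prop :=
  (0 < limn_einf (fun n => (a n / n%:R `^ u)%:E))%E /\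
  (limn_esup (fun n => (a n / n%:R `^ u)%:E) < +oo)%E.

(* The Z n may live on different probability spaces. *)
Definition cvg_in_probability (R : realType) (d : nat -> measure_display)
    (T : forall n, measurableType (d n)) (P : forall n, probability (T n) R)
    (Z : forall n, T n -> R) (l : R) : Prop :=
  forall eps : R, 0 < eps ->
    (fun n => P n [set w | eps < `|Z n w - l|]) @ \oo --> 0%E.

(* Main.v *)
Require Import Defs.
From HB Require Import structures.
From mathcomp Require Import all_boot all_order all_algebra.
From mathcomp.real_closed Require Import complex mxtens.
From mathcomp Require Import all_classical all_reals all_analysis.
From mathcomp Require Import measurable_realfun.
From mathcomp Require Import ring lra.

(* Write g for the true direction, v for the estimate, w for the weight, d for the
   gap, H for the projection onto the columns of X and c = |X alpha|^2.  The squared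
   error is at most 2 (1 - (g'v)^2), and 1 - (g'v)^2 is controlled by expanding the
   inequality g'Sg <= v'Sv for S = S(w), in which mu has disappeared.
   - If alpha <> 0, then c grows like n and w = O(d) tends to 0.  The signal term
     gives c (1 - (g'v)^2) <= 4 sum_j |(X alpha)'E e_j| + |HE|_F^2 + 2 w |E|_F^2,
     whose right-hand side has mean O(sqrt n + w n).
   - If alpha = 0, then w = 1/2 and S is proportional to the centered sample
     covariance of E.  The spectral gap of Sigma leaves n d (1 - (g'v)^2) on one side
     and deviations |Ex|^2 - n x'Sigma x of order sqrt n on the other, so the error
     tends to 0 because eta < 1/2.
   Only second and fourth moments of linear forms of E are needed, and Markov's
   inequality concludes. *)

Set Implicit Arguments.
Unset Strict Implicit.
Unset Printing Implicit Defensive.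

Import Order.TTheory GRing.Theory Num.Theory.
Import numFieldNormedType.Exports.

Local Open Scope classical_set_scope.
Local Open Scope ring_scope.

(** * Moments of the normal distribution *)

(** The Radon-Nikodym derivative of the normal law agrees almost everywhere with its density, since
    both have the same integral over every measurable set. *)
Lemma ge0_integral_normal_prob (R : realType) (s : R) (f : R -> R) :
  measurable_fun [set: R] f -> (forall x, 0 <= f x) ->
  (\int[normal_prob 0%R s]_x (f x)%:E
   = \int[lebesgue_measure]_x (f x * normal_pdf 0 s x)%:E)%E.
Proof.
move=> mf f0.
pose nu := (normal_prob 0 s : probability _ R).
have dom : nu `<< (@lebesgue_measure R) by exact: normal_prob_dominates.
have mf' : measurable_fun setT (fun x => (f x)%:E) by exact/measurable_EFinP.
rewrite -(@Radon_Nikodym_SigmaFinite.change_of_variables _ _ _ nu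
  (@lebesgue_measure R) dom (fun x => (f x)%:E))//.
have iRN := Radon_Nikodym_SigmaFinite.f_integrable dom.
apply: ae_eq_integral => //.
- by apply: emeasurable_funM => //; exact: measurable_int iRN.
- apply/measurable_EFinP; apply: measurable_funM => //.
  exact: measurable_normal_pdf.
- under [X in ae_eq _ _ _ X]eq_fun do rewrite EFinM.
  apply: ae_eqe_mul2l; apply: integral_ae_eq => //.
  + by apply/measurable_EFinP; exact: measurable_normal_pdf.
  + by move=> A _ mA; rewrite -Radon_Nikodym_SigmaFinite.f_integral.
Qed.

Section normal_moments.
Context {R : realType}.
Variable s : R.
Hypothesis s0 : s != 0.
Let g : R -> R := normal_pdf 0 s.
Local Notation mu := (@lebesgue_measure R).

Let g_ge0 x : 0 <= g x. Proof. exact: normal_pdf_ge0. Qed.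

Let g_cont : continuous g. Proof. exact: continuous_normal_pdf. Qed.

Let xg_cont k : continuous (fun x : R => x ^+ k * g x).
Proof. by move=> x; apply: cvgM; [exact: exprn_continuous|exact: g_cont]. Qed.

Let g_derive (x : R) : is_derive x 1 g (- (x / s ^+ 2) * g x).
Proof.
rewrite /g normal_pdfE// /normal_fun.
have -> : (fun x : R => normal_peak s * expR (- (x - 0) ^+ 2 / (s ^+ 2 *+ 2))) =
  (fun x : R => normal_peak s * expR (- x ^+ 2 / (s ^+ 2 *+ 2))).
  by apply/funext => y; rewrite subr0.
apply: is_derive_eq.
rewrite /GRing.scale/= subr0.
have : s ^+ 2 != 0 by rewrite expf_neq0.
by move=> ?; field.
Qed.

(** Integrating this derivative over the half line yields the recursion [M_(k+2) = s^2 (k+1) M_k]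
    between moments. *)
Let moment_step_derive k (x : R) :
  is_derive x 1 (fun x : R => x ^+ k.+1 * g x)
    (k.+1%:R * x ^+ k * g x - s ^- 2 * (x ^+ k.+2 * g x)).
Proof.
have dX : is_derive x 1 (fun y : R => y ^+ k.+1) (k.+1%:R * x ^+ k).
  have -> : (fun y : R => y ^+ k.+1) = (id : R -> R) ^+ k.+1.
    by apply/funext => y; rewrite fctE.
  by apply: is_derive_eq; rewrite /GRing.scale/= mulr1.
apply: (is_derive_eq (is_deriveM dX (g_derive x))).
rewrite /GRing.scale/= !exprS.
have : s ^+ 2 != 0 by rewrite expf_neq0.
by move=> ?; field.
Qed.

(** With [y = n^2 / (2 s^2)], the exponential series gives [expR y >= y^(k+1) / (k+1)!], so the
    boundary term is at most [C / n^(k+1) <= C / n]. *)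
Let boundary_cvg k : (fun n : nat => n%:R ^+ k.+1 * g n%:R : R) @ \oo --> (0 : R).
Proof.
pose C : R := normal_peak s * (k.+1`!%:R * (s ^+ 2 *+ 2) ^+ k.+1).
have s2 : 0 < s ^+ 2 *+ 2 by rewrite pmulrn_lgt0 ?exprn_even_gt0.
have C0 : 0 <= C.
  by rewrite !mulr_ge0 ?normal_peak_ge0 ?exprn_ge0// ltW.
have hC : (fun n : nat => C * (n%:R)^-1) @ \oo --> (0 : R).
  rewrite -(mulr0 C); apply: cvgM; first exact: cvg_cst.
  apply/gtr0_cvgV0; last exact: cvgr_idn.
  by near=> n; rewrite ltr0n; near: n; exact: nbhs_infty_gt.
apply: squeeze_cvgr (cvg_cst 0) hC; near=> n.
have n0 : (0 : R) < n%:R by rewrite ltr0n; near: n; exact: nbhs_infty_gt.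
have n1 : (1 : R) <= n%:R by rewrite ler1n; near: n; exact: nbhs_infty_gt.
rewrite mulr_ge0 ?exprn_ge0 ?g_ge0//=.
rewrite /g normal_pdfE// /normal_fun subr0 mulrCA -mulrA ler_wpM2l ?normal_peak_ge0//.
set y : R := n%:R ^+ 2 / (s ^+ 2 *+ 2).
have y0 : 0 <= y by rewrite divr_ge0 ?exprn_ge0 ?ltW.
have ly : y ^+ k.+1 / k.+1`!%:R <= expR y.
  by apply: le_trans (expR_ge1Dxn k y0); rewrite lerDr.
have ypos : 0 < y ^+ k.+1 / k.+1`!%:R.
  by rewrite divr_gt0 ?ltr0n ?fact_gt0// exprn_gt0// divr_gt0// exprn_gt0.
rewrite mulNr expRN.
apply: (@le_trans _ _ (n%:R ^+ k.+1 * (y ^+ k.+1 / k.+1`!%:R)^-1)).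
  by rewrite ler_wpM2l ?exprn_ge0// lef_pV2// posrE expR_gt0.
rewrite invf_div /y expr_div_n invf_div.
have -> : n%:R ^+ k.+1 * (k.+1`!%:R * ((s ^+ 2 *+ 2) ^+ k.+1 / (n%:R ^+ 2) ^+ k.+1))
  = k.+1`!%:R * (s ^+ 2 *+ 2) ^+ k.+1 * (n%:R ^- k.+1).
  rewrite -exprM mulnC exprM.
  have : (n%:R : R) ^+ k.+1 != 0 by rewrite expf_neq0// gt_eqF.
  by move: (_ ^+ k.+1) (_ ^+ k.+1) => u v v0; field.
rewrite ler_wpM2l ?mulr_ge0 ?exprn_ge0 ?(ltW s2)//.
rewrite lef_pV2 ?posrE ?exprn_gt0// exprS ler_peMr ?(ltW n0)//.
by rewrite exprn_ege1.
Unshelve. all: by end_near. Qed.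

(** Integration by parts on [[0, n]]. The boundary term is kept on the left, so that only
    nonnegative quantities occur when [k] is even. *)
Let integral_seg k n : (0 < n)%N ->
  (\int[mu]_(x in `[0%R, n%:R]) (x ^+ k.+2 * g x)%:E + (s ^+ 2 * (n%:R ^+ k.+1 * g n%:R))%:E
  = (s ^+ 2 * k.+1%:R)%:E * \int[mu]_(x in `[0%R, n%:R]) (x ^+ k * g x)%:E)%E.
Proof.
move=> n0.
have n0R : (0 : R) < n%:R by rewrite ltr0n.
have int_seg j : mu.-integrable `[0%R, n%:R] (fun x => (x ^+ j * g x)%:E).
  apply: continuous_compact_integrable => //; first exact: segment_compact.
  exact: continuous_subspaceT.
have := @continuous_FTC2 R
  (fun x => k.+1%:R * x ^+ k * g x - s ^- 2 * (x ^+ k.+2 * g x))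
  (fun x : R => x ^+ k.+1 * g x) 0 n%:R n0R.
have h1 : {within `[0%R, n%:R], continuous
   (fun x : R => k.+1%:R * x ^+ k * g x - s ^- 2 * (x ^+ k.+2 * g x))}.
  apply: continuous_subspaceT => x; apply: cvgB.
    under [fun _ => _]eq_fun do rewrite -mulrA.
    rewrite -mulrA.
    apply: cvgM; first exact: cvg_cst.
    exact: xg_cont.
  apply: cvgM; first exact: cvg_cst.
  exact: xg_cont.
have h2 : derivable_oo_LRcontinuous (fun x : R => x ^+ k.+1 * g x) 0 n%:R.
  split.
  - by move=> x _; have [] := moment_step_derive k x.
  - exact/cvg_at_right_filter/xg_cont.
  - exact/cvg_at_left_filter/xg_cont.
have h3 : {in `]0, n%:R[, derive1 (fun x : R => x ^+ k.+1 * g x) =1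
   (fun x => k.+1%:R * x ^+ k * g x - s ^- 2 * (x ^+ k.+2 * g x))}.
  by move=> x _; rewrite derive1E; have [_ ->] := moment_step_derive k x.
move=> /(_ h1 h2 h3).
rewrite expr0n/= mul0r sube0.
under eq_integral do rewrite EFinB -mulrA EFinM [X in (_ - X)%E]EFinM.
rewrite integralB//; last 2 first.
- exact: integrableZl.
- exact: integrableZl.
rewrite !integralZl//.
have f1 : (\int[mu]_(x in `[0%R, n%:R]) (x ^+ k * g x)%:E)%E \is a fin_num.
  exact: integrable_fin_num.
have f2 : (\int[mu]_(x in `[0%R, n%:R]) (x ^+ k.+2 * g x)%:E)%E \is a fin_num.
  exact: integrable_fin_num.
rewrite -(fineK f1) -(fineK f2) -!EFinM -!EFinB -!EFinD => -[] <-.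
congr EFin.
have : s ^+ 2 != 0 by rewrite expf_neq0.
by move=> ?; field.
Qed.

Let xg_ge0 k x : ~~ odd k -> 0 <= x ^+ k * g x.
Proof. by move=> ek; rewrite mulr_ge0// exprn_even_ge0. Qed.

Let xg_meas k : measurable_fun [set: R] (fun x : R => x ^+ k * g x).
Proof. exact: continuous_measurable_fun. Qed.

(** Monotone convergence on both integrals of the previous identity, while its boundary term
    vanishes. Parity of [k] makes the integrands nonnegative. *)
Let integral_half k : ~~ odd k ->
  (\int[mu]_(x in `[0%R, +oo[) (x ^+ k.+2 * g x)%:E
  = (s ^+ 2 * k.+1%:R)%:E * \int[mu]_(x in `[0%R, +oo[) (x ^+ k * g x)%:E)%E.
Proof.
move=> ek.
have ek2 : ~~ odd k.+2 by rewrite /= negbK.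
have c1 := @ge0_cvgn_integral R mu _ (fun x => @xg_ge0 k.+2 x ek2) (xg_meas k.+2).
have c2 := @ge0_cvgn_integral R mu _ (fun x => @xg_ge0 k x ek) (xg_meas k).
have c3 : (fun n : nat => (s ^+ 2 * (n%:R ^+ k.+1 * g n%:R))%:E) @ \oo --> (0%:E : \bar R).
  apply: cvg_EFin; first exact: nearW.
  rewrite -(mulr0 (s ^+ 2)); apply: cvgM; first exact: cvg_cst.
  exact: boundary_cvg.
have fin0 : (\int[mu]_(x in `[0%R, +oo[) (x ^+ k.+2 * g x)%:E +? 0)%E.
  exact: fin_num_adde_defl.
have c12 := cvgeD fin0 c1 c3.
have c4 : ((s ^+ 2 * k.+1%:R)%:E * \int[mu]_(x in `[0%R, n%:R]) (x ^+ k * g x)%:E)%E @[n --> \oo] -->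
  ((s ^+ 2 * k.+1%:R)%:E * \int[mu]_(x in `[0%R, +oo[) (x ^+ k * g x)%:E)%E.
  exact: cvgeZl.
rewrite -[LHS]adde0 -(cvg_lim (@ereal_hausdorff R) (c12 _)); apply: cvg_lim => //.
apply: cvg_trans c4; apply: near_eq_cvg; near=> n.
rewrite integral_seg//; near: n; exact: nbhs_infty_gt.
Unshelve. all: by end_near. Qed.

Let integral_full k : ~~ odd k ->
  (\int[mu]_x (x ^+ k.+2 * g x)%:E
  = (s ^+ 2 * k.+1%:R)%:E * \int[mu]_x (x ^+ k * g x)%:E)%E.
Proof.
move=> ek.
have ek2 : ~~ odd k.+2 by rewrite /= negbK.
have ev j : ~~ odd j -> (fun x : R => x ^+ j * g x) =1 (fun x : R => x ^+ j * g x) \o -%R.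
  move=> ej x /=; rewrite exprNn -signr_odd (negbTE ej) mul1r; congr (_ * _).
  by rewrite /g !normal_pdfE// /normal_fun !subr0 sqrrN.
rewrite ge0_symfun_integralT//; first last.
- exact: ev.
- by move=> x; exact: xg_ge0.
rewrite (@ge0_symfun_integralT _ (fun x => x ^+ k * g x))//; first last.
- exact: ev.
- by move=> x; exact: xg_ge0.
by rewrite -set_itvcy integral_half// muleCA.
Qed.

Lemma integral_normal_prob_sqr :
  (\int[normal_prob 0 s]_x (x ^+ 2)%:E = (s ^+ 2)%:E)%E.
Proof.
rewrite ge0_integral_normal_prob//; last by move=> x; rewrite sqr_ge0.
rewrite (@integral_full 0)// mulr1.
under eq_integral do rewrite expr0 mul1r.
by rewrite integral_normal_pdf mule1.
Qed.

Lemma integral_normal_prob_quartic :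
  (\int[normal_prob 0 s]_x (x ^+ 4)%:E = (3 * s ^+ 4)%:E)%E.
Proof.
rewrite ge0_integral_normal_prob//; last by move=> x; rewrite exprn_even_ge0.
rewrite (@integral_full 2)// (@integral_full 0)// mulr1.
under eq_integral do rewrite expr0 mul1r.
rewrite integral_normal_pdf mule1 -EFinM; congr EFin; ring.
Qed.

End normal_moments.

(** * Quadratic forms of symmetric matrices *)

(** Over polynomials, [U (X - A) = (X - B) U]; take determinants and cancel the nonzero [det U]. *)
Lemma char_poly_conj (F : fieldType) (n : nat) (U A B : 'M[F]_n) :
  U \in unitmx -> U *m A = B *m U -> char_poly A = char_poly B.
Proof.
move=> Uu UA.
have e : map_mx polyC U *m char_poly_mx A = char_poly_mx B *m map_mx polyC U.
  rewrite /char_poly_mx mulmxBr mulmxBl -!map_mxM UA.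
  by rewrite scalar_mxC.
have := congr1 determinant e; rewrite !det_mulmx mulrC => /mulIf; apply.
by rewrite det_map_mx polyC_eq0 -unitfE -unitmxE.
Qed.

(** Seen over [R[i]], a real symmetric matrix is Hermitian, hence unitarily diagonalizable with real
    eigenvalues. The factorization of [char_poly] descends to [R] because the embedding of
    polynomials is injective. *)
Lemma symmetric_spectral (R : realType) (m : nat) (S : 'M[R]_m) : S^T = S ->
  exists (D : 'I_m -> R) (U : 'M[R[i]]_m),
  [/\ U *m (map_mx Num.conj U)^T = 1%:M,
      U *m map_mx (real_complex R) S = diag_mx (\row_k (real_complex R (D k))) *m U &
      char_poly S = \prod_k ('X - (D k)%:P)].
Proof.
move=> Ssym.
pose A := map_mx (real_complex R) S.
have Aherm : A \is hermsymmx.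
  apply/is_hermitianmxP; rewrite expr0 scale1r; apply/matrixP => i j.
  rewrite !mxE -[in LHS]Ssym mxE; by rewrite conj_Creal// complex_real.
have Aeq := orthomx_spectralP (hermitian_normalmx Aherm).
have /mxOverP Dreal := hermitian_spectral_diag_real Aherm.
set U := spectralmx A in Aeq; set sp := spectral_diag A in Aeq Dreal.
have Uun : U \is unitarymx by exact: spectral_unitarymx.
have Uunit : U \in unitmx by exact: unitarymx_unit.
pose D k := complex.Re (sp 0 k).
have spE k : sp 0 k = real_complex R (D k).
  by rewrite /D; have /complex_realP[x ->] := Dreal 0 k.
have spD : sp = \row_k (real_complex R (D k)).
  by apply/rowP => k; rewrite mxE spE.
exists D, U; split.
- by have /unitarymxP := Uun; rewrite map_trmx.
- by rewrite -spD -/A Aeq !mulmxA mulmxV// mul1mx.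
- apply: (map_poly_inj (real_complex R)); rewrite map_char_poly -/A.
  rewrite rmorph_prod /=.
  under eq_bigr do rewrite rmorphB/= map_polyX map_polyC/=.
  have -> : char_poly A = char_poly (diag_mx sp).
    by apply: (char_poly_conj (U := U)) => //; rewrite Aeq !mulmxA mulmxV// mul1mx.
  rewrite char_poly_trig ?diag_mx_is_trig//.
  by apply: eq_bigr => k _; rewrite mxE eqxx mulr1n spE.
Qed.

Definition dotc (R : realType) (m : nat) (u v : 'cV[R]_m) : R := (u^T *m v) 0 0.

Lemma dotcE (R : realType) (m : nat) (u v : 'cV[R]_m) :
  dotc u v = \sum_i u i 0 * v i 0.
Proof. by rewrite /dotc mxE; apply: eq_bigr => i _; rewrite mxE. Qed.

Lemma enorm_sqr (R : realType) (m : nat) (v : 'cV[R]_m) : enorm v ^+ 2 = dotc v v.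
Proof.
rewrite /enorm sqr_sqrtr ?sumr_ge0// ?dotcE; last by move=> i _; rewrite sqr_ge0.
by apply: eq_bigr => i _; rewrite expr2.
Qed.

(* Coordinates in a complex orthonormal eigenbasis: the library diagonalizes
   normal matrices over algebraically closed fields only. *)
Lemma symmetric_coordinates (R : realType) (m : nat) (S : 'M[R]_m) : S^T = S ->
  exists (D : 'I_m -> R) (y : 'cV[R]_m -> 'I_m -> R[i]),
  [/\ forall u v, real_complex R (dotc u v) = \sum_k (y u k)^* * y v k,
      forall u k, y (S *m u) k = real_complex R (D k) * y u k,
      forall l u k, y (l *: u) k = real_complex R l * y u k &
      char_poly S = \prod_k ('X - (D k)%:P)].
Proof.
move=> /symmetric_spectral[D [U [UU US cS]]].
pose y (u : 'cV[R]_m) k := (U *m map_mx (real_complex R) u) k 0.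
exists D, y; split => //.
- move=> u v.
  have -> : real_complex R (dotc u v) =
      ((map_mx (real_complex R) u)^T *m map_mx (real_complex R) v) 0 0.
    rewrite /dotc !mxE rmorph_sum; apply: eq_bigr => i _.
    by rewrite !mxE rmorphM.
  have UU' := mulmx1C UU.
  rewrite -[map_mx _ v]mul1mx -UU' -!mulmxA mulmxA mxE.
  apply: eq_bigr => k _; congr (_ * _).
  rewrite /y !mxE rmorph_sum; apply: eq_bigr => j _.
  by rewrite !mxE rmorphM/= mulrC; congr (_ * _); rewrite conj_Creal// complex_real.
- move=> u k; rewrite /y map_mxM mulmxA US -mulmxA mul_diag_mx.
  by rewrite !mxE.
- by move=> l u k; rewrite /y map_mxZ -scalemxAr mxE.
Qed.

(** In eigencoordinates the form is [sum_k D_k |y_k|^2], and each [D_k] is an eigenvalue, being a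
    root of [char_poly S]. *)
Lemma dotc_symmetric_le (R : realType) (m : nat) (S : 'M[R]_m) (l : R) : S^T = S ->
  (forall k, eigenvalue S k -> k <= l) ->
  forall x, dotc x (S *m x) <= l * dotc x x.
Proof.
move=> /symmetric_coordinates[D [y [ydot yS _ cS]]] Sl x.
have Dl k : D k <= l.
  apply: Sl; rewrite eigenvalue_root_char cS rootE horner_prod.
  by rewrite (bigD1 k)//= hornerXsubC subrr mul0r.
rewrite -lecR rmorphM/= !ydot mulr_sumr ler_sum// => k _.
rewrite yS mulrCA ler_wpM2r ?lecR//.
by rewrite mulrC mul_conjC_ge0.
Qed.

(** Exactly one eigencoordinate carries [lam 1]; its squared modulus at [x] is [(g'x)^2], and all
    the others have eigenvalue at most [lam 2]. *)
Lemma dotc_spectral_gap (R : realType) (p : nat) (S : 'M[R]_p) (lam : nat -> R)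
    (g : 'cV[R]_p) : (1 < p)%N -> S^T = S -> ordered_eigenvalues S lam ->
  lam 2%N < lam 1%N -> unit_eigenvector S (lam 1%N) g ->
  forall x, dotc x (S *m x) <=
    lam 1%N * dotc g x ^+ 2 + lam 2%N * (dotc x x - dotc g x ^+ 2).
Proof.
move=> p1 /symmetric_coordinates[D [y [ydot yS yZ cS]]] [cl lamdec] gap [Sg g1] x.
have lam_le i : (2 <= i <= p)%N -> lam i <= lam 2%N.
  elim: i => // i IH /andP[i2 ip].
  have [i1|i2'] := leqP i 1; first by have -> : i = 1%N by apply/eqP; rewrite eqn_leq i1.
  apply: le_trans (IH _); last by rewrite i2' ltnW.
  by apply: lamdec; rewrite ip andbT ltnW.
(* Two factorizations of the same polynomial into monic linear factors have the same roots with
   multiplicity. *)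
have peq : perm_eq [seq D k | k <- index_enum 'I_p] [seq lam i | i <- index_iota 1 p.+1].
  by apply: prod_XsubC_eq; rewrite !big_map -cS -cl.
have idx : index_iota 1 p.+1 = 1%N :: index_iota 2 p.+1.
  by rewrite /index_iota !subSS subn0 subn1 -{1}(ltn_predK p1).
have [k0 Dk0] : exists k0, D k0 = lam 1%N.
  have : lam 1%N \in [seq D k | k <- index_enum 'I_p].
    by rewrite (perm_mem peq) idx/= mem_head.
  by case/mapP => k _ ->; exists k.
have Dk k : k != k0 -> D k <= lam 2%N.
  move=> kk0.
  (* Removing one copy of [lam 1] from both lists leaves [D k] among [lam 2, ..., lam p]. *)
  have peq' : perm_eq [seq D k | k <- rem k0 (index_enum 'I_p)]
      [seq lam i | i <- index_iota 2 p.+1].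
    rewrite -(perm_cons (lam 1%N)); move: peq; rewrite idx/= => peq.
    apply: perm_trans peq; rewrite -Dk0 -map_cons perm_map// perm_sym perm_to_rem//.
    by rewrite mem_index_enum.
  have : D k \in [seq D k | k <- rem k0 (index_enum 'I_p)].
    apply: map_f; rewrite mem_rem_uniq ?index_enum_uniq// inE kk0.
    by rewrite mem_index_enum.
  rewrite (perm_mem peq'); case/mapP => i.
  by rewrite mem_index_iota => ip ->; apply: lam_le; move: ip; rewrite ltnS.
(* Eigencoordinates of [g] vanish wherever the eigenvalue differs from [lam 1]; the strict gap
   leaves only [k0]. *)
have yg k : k != k0 -> y g k = 0.
  move=> /Dk Dk2; have := yS g k; rewrite Sg yZ => /eqP.
  rewrite -subr_eq0 -mulrBl mulf_eq0 -rmorphB/= => /orP[|/eqP//].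
  rewrite fmorph_eq0 subr_eq0 => /eqP Dk1.
  by move: gap; rewrite Dk1 ltNge Dk2.
have yg0 : (y g k0)^* * y g k0 = 1.
  have := ydot g g; rewrite -enorm_sqr g1 expr1n rmorph1 (bigD1 k0)//= big1 ?addr0//.
  by move=> k /yg ->; rewrite mulr0.
(* The unknown phase of [y g k0] cancels by writing the real number [g'x] once as itself and once as
   its conjugate. *)
have gx : real_complex R (dotc g x ^+ 2) = (y x k0)^* * y x k0.
  have e : real_complex R (dotc g x) = (y g k0)^* * y x k0.
    rewrite ydot (bigD1 k0)//= big1 ?addr0//.
    by move=> k /yg ->; rewrite rmorph0 mul0r.
  have e' : real_complex R (dotc g x) = y g k0 * (y x k0)^*.
    rewrite -[LHS]conj_Creal; last by rewrite complex_real.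
    by rewrite e rmorphM/= conjCK.
  rewrite rmorphXn/= expr2 {1}e e'.
  rewrite -[RHS]mul1r -yg0; move: (y g k0) (y g k0)^* (y x k0) (y x k0)^* => a b u v.
  by ring.
move: (dotc g x ^+ 2) gx => q gx.
rewrite -lecR !rmorphD !rmorphM/= rmorphB/= gx !ydot.
rewrite [leLHS](bigD1 k0)//= [X in _ <= _ + _ * (X - _)](bigD1 k0)//=.
rewrite yS Dk0 mulrCA lerD2l [X in X - _]addrC addrK mulr_sumr ler_sum// => k /Dk Dk2.
rewrite yS mulrCA ler_wpM2r ?lecR//.
by rewrite mulrC mul_conjC_ge0.
Qed.

(** * Algebra of the dot product and of symmetric forms *)

Section dotc_theory.
Context {R : realType} {m : nat}.
Implicit Types (x y z : 'cV[R]_m) (A : 'M[R]_m).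

Lemma dotcC x y : dotc x y = dotc y x.
Proof. by rewrite !dotcE; apply: eq_bigr => i _; rewrite mulrC. Qed.

Lemma dotcDl x y z : dotc (x + y) z = dotc x z + dotc y z.
Proof. by rewrite /dotc linearD/= mulmxDl mxE. Qed.

Lemma dotcNl x z : dotc (- x) z = - dotc x z.
Proof. by rewrite /dotc linearN/= mulNmx mxE. Qed.

Lemma dotcZl c x z : dotc (c *: x) z = c * dotc x z.
Proof. by rewrite /dotc linearZ/= -scalemxAl mxE. Qed.

Lemma dotcDr x y z : dotc z (x + y) = dotc z x + dotc z y.
Proof. by rewrite dotcC dotcDl !(dotcC z). Qed.

Lemma dotcNr x z : dotc z (- x) = - dotc z x.
Proof. by rewrite dotcC dotcNl (dotcC z). Qed.

Lemma dotcZr c x z : dotc z (c *: x) = c * dotc z x.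
Proof. by rewrite dotcC dotcZl (dotcC z). Qed.

Lemma dotc_ge0 x : 0 <= dotc x x.
Proof. by rewrite -enorm_sqr sqr_ge0. Qed.

Lemma dotc_delta i x : dotc (delta_mx i 0) x = x i 0.
Proof.
rewrite dotcE (bigD1 i)//= big1 ?addr0; first by rewrite !mxE !eqxx mul1r.
by move=> j ji; rewrite !mxE (negbTE ji) mul0r.
Qed.

Lemma dotc_mulmx_delta A i j : dotc (delta_mx i 0) (A *m delta_mx j 0) = A i j.
Proof. by rewrite dotc_delta -colE mxE. Qed.

Lemma dotc_mulmx_expand A x : dotc x (A *m x) = \sum_i \sum_j x i 0 * x j 0 * A i j.
Proof.
rewrite dotcE; apply: eq_bigr => i _; rewrite mxE mulr_sumr; apply: eq_bigr => j _.
by rewrite mulrAC mulrA.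
Qed.

Lemma dotc_coord_le1 x i : dotc x x = 1 -> `|x i 0| <= 1.
Proof.
move=> x1; rewrite -(@expr_le1 _ 2)// real_normK ?num_real// -x1 dotcE (bigD1 i)//=.
by rewrite -expr2 lerDl sumr_ge0// => j _; rewrite -expr2 sqr_ge0.
Qed.

(** The squared norm of [(y'y) x - (x'y) y] is [y'y] times the difference of the two sides; the case
    [y'y = 0] is separate. *)
Lemma dotc_cauchy x y : dotc x y ^+ 2 <= dotc x x * dotc y y.
Proof.
have [y0|y0] := eqVneq (dotc y y) 0.
  have -> : y = 0.
    apply/colP => i; rewrite mxE; apply/eqP; rewrite -sqrf_eq0; apply/eqP.
    apply/eqP; rewrite eq_le sqr_ge0 andbT -y0 dotcE (bigD1 i)//= expr2 lerDl.
    by rewrite sumr_ge0// => j _; rewrite -expr2 sqr_ge0.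
  by rewrite /dotc !mulmx0 mxE expr0n/= mulr0.
have yp : 0 < dotc y y by rewrite lt0r y0 dotc_ge0.
have := dotc_ge0 (dotc y y *: x + (- dotc x y) *: y).
rewrite !dotcDl !dotcDr !dotcZl !dotcZr (dotcC y x) => h.
rewrite -subr_ge0 -(pmulr_rge0 _ yp); apply: le_trans h _.
by rewrite le_eqVlt; apply/orP; left; apply/eqP; ring.
Qed.

Section symmetric.
Variable A : 'M[R]_m.
Hypothesis Asym : A^T = A.

Lemma dotc_mulmx_sym x y : dotc x (A *m y) = dotc y (A *m x).
Proof. by rewrite dotcC /dotc trmx_mul Asym mulmxA. Qed.

Lemma dotc_parallelogram x y :
  dotc (x + y) (A *m (x + y)) + dotc (x - y) (A *m (x - y)) =
  2 * (dotc x (A *m x) + dotc y (A *m y)).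
Proof.
rewrite !mulmxDr !mulmxN !dotcDl !dotcDr !dotcNl !dotcNr; ring.
Qed.

Lemma dotc_polarization x y :
  dotc (x + y) (A *m (x + y)) - dotc (x - y) (A *m (x - y)) = 4 * dotc x (A *m y).
Proof.
rewrite !mulmxDr !mulmxN !dotcDl !dotcDr !dotcNl !dotcNr (dotc_mulmx_sym y x); ring.
Qed.

End symmetric.

End dotc_theory.

Lemma dotc_mulmxl (R : realType) (n m : nat) (B : 'M[R]_(n, m)) (x : 'cV[R]_m) (y : 'cV[R]_n) :
  dotc (B *m x) y = dotc x (B^T *m y).
Proof. by rewrite /dotc trmx_mul mulmxA. Qed.

(** * Means and Gaussian matrices *)

(** Integrability and value are bundled so that moments of linear combinations reduce to algebra in
    [R], away from the extended reals. *)
Definition has_mean (R : realType) (d : measure_display) (T : measurableType d)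
    (P : probability T R) (f : T -> R) (r : R) : Prop :=
  P.-integrable [set: T] (fun x => (f x)%:E) /\ (\int[P]_x (f x)%:E = r%:E)%E.

Section has_mean.
Context {R : realType} {d : measure_display} {T : measurableType d}.
Variable P : probability T R.
Implicit Types (f g : T -> R) (r s : R).

Lemma has_mean_ext f g r s : has_mean P f r -> f =1 g -> r = s -> has_mean P g s.
Proof. by move=> h fg <-; rewrite (_ : g = f)//; apply/funext => x. Qed.

Lemma has_mean_cst r : has_mean P (fun=> r) r.
Proof.
split; first exact: finite_measure_integrable_cst.
rewrite integral_cst// -[RHS]mule1; congr (_ * _)%E; exact: probability_setT.
Qed.

Lemma has_meanD f g r s : has_mean P f r -> has_mean P g s ->
  has_mean P (fun x => f x + g x) (r + s).
Proof.
move=> [fi fr] [gi gs]; split.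
  by under eq_fun do rewrite EFinD; exact: integrableD.
by under eq_integral do rewrite EFinD; rewrite integralD// fr gs.
Qed.

Lemma has_meanZ (c : R) f r : has_mean P f r -> has_mean P (fun x => c * f x) (c * r).
Proof.
move=> [fi fr]; split.
  by under eq_fun do rewrite EFinM; exact: integrableZl.
by under eq_integral do rewrite EFinM; rewrite integralZl// fr.
Qed.

Lemma has_mean_sum (I : Type) (l : seq I) (F : I -> T -> R) (r : I -> R) :
  (forall i, has_mean P (F i) (r i)) ->
  has_mean P (fun x => \sum_(i <- l) F i x) (\sum_(i <- l) r i).
Proof.
move=> h; elim: l => [|i l IH].
  apply: has_mean_ext (has_mean_cst 0) _ _; last by rewrite big_nil.
  by move=> x; rewrite big_nil.
apply: has_mean_ext (has_meanD (h i) IH) _ _; last by rewrite big_cons.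
by move=> x; rewrite big_cons.
Qed.

Lemma has_mean_ge0 f r : measurable_fun [set: T] f -> (forall x, 0 <= f x) ->
  (\int[P]_x (f x)%:E = r%:E)%E -> has_mean P f r.
Proof.
move=> mf f0 fr; split => //; apply/integrableP; split; first exact/measurable_EFinP.
under eq_integral do rewrite /= ger0_norm//.
by rewrite fr ltry.
Qed.

(** Markov's inequality: [eps^2] times the indicator of the event is at most [Z^2 <= U]. The mean of
    [Z^2] never has to be computed, only that of the majorant. *)
Lemma prob_gt_le_mean (Z U : T -> R) (r eps : R) : 0 < eps ->
  measurable_fun [set: T] Z -> (forall x, 0 <= Z x) -> (forall x, Z x ^+ 2 <= U x) ->
  has_mean P U r -> (P [set x | (eps < `|Z x - 0|)%R] <= (r / eps ^+ 2)%:E)%E.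
Proof.
move=> e0 mZ Z0 ZU [Ui Ur].
set A := [set x | _].
have mA : measurable A.
  rewrite /A; under eq_set do rewrite subr0 ger0_norm//.
  have := mZ measurableT `]eps, +oo[%classic (measurable_itv _).
  rewrite setTI; congr measurable; apply/seteqP; split=> x /=;
  by rewrite in_itv/= andbT.
have e2 : 0 < eps ^+ 2 by rewrite exprn_gt0.
rewrite EFinM lee_pdivlMr// -Ur muleC.
have -> : (P A = \int[P]_x (\1_A x)%:E)%E by rewrite integral_indic// setIT.
rewrite -ge0_integralZl//; last 2 first.
- by apply/measurable_EFinP; exact: measurable_indic.
- by rewrite lee_fin ltW.
apply: ge0_le_integral => //=.
- by move=> x _; rewrite mule_ge0 ?lee_fin ?(ltW e2).
- apply: measurable_funeM; apply/measurable_EFinP; exact: measurable_indic.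
- exact: measurable_int Ui.
- move=> x _; rewrite -EFinM lee_fin indicE; case: (boolP (x \in A)).
    rewrite inE /A/= subr0 ger0_norm// mulr1 => /ltW le.
    by apply: le_trans (ZU x); rewrite ler_sqr ?nnegrE// ltW.
  by move=> _; rewrite mulr0; apply: le_trans (ZU x); rewrite sqr_ge0.
Qed.

(** The moments are computed under the pushforward law. For [v = 0] it is the Dirac mass at 0 and
    both moments vanish. *)
Lemma normal_law_moments (X : T -> R) (v : R) : 0 <= v -> measurable_fun [set: T] X ->
  (forall B, measurable B -> P (X @^-1` B) = normal_law 0 v B) ->
  has_mean P (fun x => X x ^+ 2) v /\ has_mean P (fun x => X x ^+ 4) (3 * v ^+ 2).
Proof.
move=> v0 mX XP.
have key k : ~~ odd k -> (\int[P]_x (X x ^+ k)%:E =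
    if (v == 0)%R then (0 ^+ k)%:E else \int[normal_prob 0%R (Num.sqrt v)]_y (y ^+ k)%:E)%E.
  move=> ek.
  (* [normal_prob] lives on [measurableTypeR R], whose display differs from that of R. *)
  pose X' : T -> measurableTypeR R := X.
  have mX' : measurable_fun [set: T] X' by exact: mX.
  have mk : measurable_fun [set: measurableTypeR R] (fun y => ((y : R) ^+ k)%:E).
    by apply/measurable_EFinP; exact: measurable_funX.
  transitivity (\int[pushforward P X']_y ((y : R) ^+ k)%:E)%E.
    rewrite ge0_integral_pushforward//.
    by move=> y _; rewrite lee_fin exprn_even_ge0.
  case: ifPn => v00.
    rewrite (@eq_measure_integral _ _ _ _ (dirac (0 : measurableTypeR R)))//.
      by rewrite integral_dirac//= diracE in_setT mul1e.
    by move=> A mA _; apply: etrans (XP A mA) _; rewrite /normal_law v00.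
  apply: eq_measure_integral => A mA _.
  by apply: etrans (XP A mA) _; rewrite /normal_law (negbTE v00).
have sv : Num.sqrt v ^+ 2 = v by rewrite sqr_sqrtr.
split; apply: has_mean_ge0.
- exact: measurable_funX.
- by move=> x; rewrite sqr_ge0.
- rewrite key//; have [->|vn0] := eqVneq; first by rewrite expr0n.
  by rewrite integral_normal_prob_sqr ?sv// sqrtr_eq0 -ltNge lt0r vn0.
- exact: measurable_funX.
- by move=> x; rewrite exprn_even_ge0.
- rewrite key//; have [->|vn0] := eqVneq; first by rewrite !expr0n mulr0.
  rewrite integral_normal_prob_quartic ?sqrtr_eq0 -?ltNge ?lt0r ?vn0//.
  by rewrite (exprM _ 2 2) sv.
Qed.

End has_mean.

Lemma sum_mxtens (R : realType) (p n : nat) (F : 'I_(p * n) -> R) :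
  \sum_k F k = \sum_i \sum_j F (mxtens_index (i, j)).
Proof.
rewrite pair_big/= (reindex (@mxtens_index p n))/=.
  by apply: eq_bigr => -[].
by exists (@mxtens_unindex p n) => k _; rewrite ?mxtens_indexK ?mxtens_unindexK.
Qed.

(** * Moments and concentration for the Gaussian noise matrix *)

Section gaussian_noise.
Context {R : realType} {d : measure_display} {T : measurableType d}.
Variables (P : probability T R) (n p : nat) (Sigma : 'M[R]_p) (E : T -> 'M[R]_(n, p)).
Hypothesis Spos : posdef Sigma.
Hypothesis EN : multivariate_normal P (fun w => vec (E w)) 0 (tensmx Sigma 1%:M).

Lemma posdef_ge0 (v : 'cV[R]_p) : 0 <= dotc v (Sigma *m v).
Proof.
have [->|v0] := eqVneq v 0; first by rewrite mulmx0 /dotc mulmx0 mxE.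
by rewrite ltW// /dotc mulmxA; apply: Spos.2.
Qed.

(** [u'Ev] is the linear form of [vec E] with coefficients [vec (u v')], and the Kronecker
    covariance factors its variance into [(u'u)(v' Sigma v)]. *)
Lemma bilinear_moments (u : 'cV[R]_n) (v : 'cV[R]_p) :
  let s2 := dotc u u * dotc v (Sigma *m v) in
  has_mean P (fun w => dotc u (E w *m v) ^+ 2) s2 /\
  has_mean P (fun w => dotc u (E w *m v) ^+ 4) (3 * s2 ^+ 2).
Proof.
move=> s2.
have [] := EN (vec (u *m v^T)).
rewrite mulmx0; have -> : (0 : 'M[R]_1) 0 0 = 0 by rewrite mxE.
have vecE (M : 'M[R]_(n, p)) i j : vec M (mxtens_index (i, j)) 0 = M j i.
  by rewrite mxE mxtens_indexK.
have outE j i : (u *m v^T) j i = u j 0 * v i 0.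
  by rewrite mxE big_ord1 [v^T _ _]mxE.
have tensE i0 j0 i j : (Sigma *t 1%:M) (mxtens_index (i0, j0)) (mxtens_index (i, j)) =
    Sigma i0 i * (j0 == j)%:R :> R.
  by rewrite mxE !mxtens_indexK/= [1%:M _ _]mxE.
have -> : ((vec (u *m v^T))^T *m tensmx Sigma 1%:M *m vec (u *m v^T)) 0 0 = s2.
  rewrite -mulmxA -/(dotc _ _) dotcE sum_mxtens /s2 !dotcE mulrC big_distrl.
  apply: eq_bigr => i _ /=; rewrite mulr_sumr; apply: eq_bigr => j _.
  rewrite vecE outE [X in _ * X]mxE sum_mxtens [(Sigma *m v) i 0]mxE.
  have -> : \sum_i0 \sum_j0 (Sigma *t 1%:M) (mxtens_index (i, j)) (mxtens_index (i0, j0)) *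
      vec (u *m v^T) (mxtens_index (i0, j0)) 0 =
      \sum_i0 Sigma i i0 * (u j 0 * v i0 0).
    apply: eq_bigr => i0 _; rewrite (bigD1 j)//= big1 ?addr0.
      by rewrite tensE vecE outE eqxx mulr1.
    by move=> j0 j0j; rewrite tensE eq_sym (negbTE j0j) mulr0 mul0r.
  rewrite !mulr_sumr mulr_suml; apply: eq_bigr => i0 _ /=.
  by ring.
have -> : (fun w => ((vec (u *m v^T))^T *m vec (E w)) 0 0) =
    (fun w => dotc u (E w *m v)).
  apply/funext => w; rewrite -/(dotc _ _) !dotcE sum_mxtens exchange_big.
  apply: eq_bigr => j _ /=; rewrite [(E w *m v) j 0]mxE mulr_sumr.
  by apply: eq_bigr => i _; rewrite !vecE outE; ring.
by move=> mX XP; apply: normal_law_moments => //; rewrite mulr_ge0 ?dotc_ge0 ?posdef_ge0.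
Qed.

Definition quad_dev (t : 'cV[R]_p) (w : T) : R :=
  dotc (E w *m t) (E w *m t) - n%:R * dotc t (Sigma *m t).

(* The rows enter only through fourth moments of linear forms: the mixed moment
   of two rows is obtained by polarization,
   12 a^2 b^2 = (a + b)^4 + (a - b)^4 - 2 a^4 - 2 b^4. *)
Lemma quad_dev_moment (t : 'cV[R]_p) :
  has_mean P (fun w => quad_dev t w ^+ 2) (2 * n%:R * dotc t (Sigma *m t) ^+ 2).
Proof.
set s := dotc t (Sigma *m t).
pose e (k : 'I_n) : 'cV[R]_n := delta_mx k 0.
pose G k w : R := (E w *m t) k 0.
have m2 k : has_mean P (fun w => G k w ^+ 2) s.
  have [h _] := bilinear_moments (e k) t.
  apply: has_mean_ext h _ _ => [w|]; rewrite dotc_delta//.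
  by rewrite !mxE !eqxx mul1r.
have m4 k : has_mean P (fun w => G k w ^+ 4) (3 * s ^+ 2).
  have [_ h] := bilinear_moments (e k) t.
  apply: has_mean_ext h _ _ => [w|]; rewrite dotc_delta//.
  by rewrite !mxE !eqxx mul1r.
have m22 k l : k != l -> has_mean P (fun w => G k w ^+ 2 * G l w ^+ 2) (s ^+ 2).
  move=> kl.
  have ekl : e k l 0 = 0 by rewrite mxE eq_sym (negbTE kl).
  have elk : e l k 0 = 0 by rewrite mxE (negbTE kl).
  have ekk j : e j j 0 = 1 by rewrite mxE !eqxx.
  have [_ hp] := bilinear_moments (e k + e l) t.
  have [_ hm] := bilinear_moments (e k - e l) t.
  have h := has_meanD (has_meanZ (12^-1) (has_meanD hp hm))
    (has_meanZ (- 6^-1) (has_meanD (m4 k) (m4 l))).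
  apply: has_mean_ext h _ _ => [w|].
    by rewrite !dotcDl dotcNl !dotc_delta -/(G k w) -/(G l w); field.
  have addE (x y : 'cV[R]_n) i : (x + y) i 0 = x i 0 + y i 0 by rewrite mxE.
  have oppE (x : 'cV[R]_n) i : (- x) i 0 = - x i 0 by rewrite mxE.
  rewrite !dotcDl !dotcNl !dotc_delta !addE !oppE ekl elk !ekk -/s.
  by field.
(* Squares of distinct rows are uncorrelated; on the diagonal the variance is [3 s^2 - s^2]. *)
have m22' k l : has_mean P (fun w => (G k w ^+ 2 - s) * (G l w ^+ 2 - s))
    (if k == l then 2 * s ^+ 2 else 0).
  have h r : has_mean P (fun w => G k w ^+ 2 * G l w ^+ 2) r ->
      has_mean P (fun w => (G k w ^+ 2 - s) * (G l w ^+ 2 - s)) (r - s ^+ 2).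
    move=> hr.
    have h := has_meanD hr (has_meanD (has_meanZ (- s) (has_meanD (m2 k) (m2 l)))
      (has_mean_cst P (s ^+ 2))).
    by apply: has_mean_ext h _ _ => [w|]; ring.
  move: h; have [->|kl] := eqVneq k l => h.
    apply: has_mean_ext (h (3 * s ^+ 2) _) _ _ => //; last by ring.
    by apply: has_mean_ext (m4 l) _ _ => // w; ring.
  apply: has_mean_ext (h (s ^+ 2) (m22 k l kl)) _ _ => //; ring.
have h := has_mean_sum (index_enum 'I_n) (fun k => has_mean_sum (index_enum 'I_n) (m22' k)).
apply: has_mean_ext h _ _ => [w|].
  under eq_bigr do rewrite -mulr_sumr.
  rewrite -mulr_suml -expr2; congr (_ ^+ 2).
  rewrite /quad_dev -/s sumrB sumr_const card_ord dotcE -[s *+ n]mulr_natl; congr (_ - _).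
rewrite (eq_bigr (fun=> 2 * s ^+ 2)); last first.
  by move=> k _; rewrite (bigD1 k)//= eqxx big1 ?addr0// => l lk; rewrite eq_sym (negbTE lk).
by rewrite sumr_const card_ord -mulr_natl; ring.
Qed.

(** The estimated eigenvector is random, so the bound must hold for all unit [v] at once.
    Polarization controls every entry of [E'E - n Sigma] by deviations at the fixed vectors
    [e i + e j] and [e i - e j], which [W] collects. The parameter [tau] is free for later
    balancing. *)
Lemma quadratic_form_concentration : exists (W : T -> R) (r : R),
  [/\ has_mean P W r, r <= 32 * p%:R ^+ 2 * n%:R * (\tr Sigma) ^+ 2 &
   forall w (v : 'cV[R]_p) tau, 0 < tau -> dotc v v = 1 ->
   `|dotc (E w *m v) (E w *m v) - n%:R * dotc v (Sigma *m v)|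
     <= 2^-1 * (p%:R ^+ 2 * tau + W w / (8 * tau))].
Proof.
pose e (k : 'I_p) : 'cV[R]_p := delta_mx k 0.
pose s (t : 'cV[R]_p) := dotc t (Sigma *m t).
pose W w := \sum_i \sum_j (quad_dev (e i + e j) w ^+ 2 + quad_dev (e i - e j) w ^+ 2).
exists W; eexists; split.
- apply: has_mean_sum => i; apply: has_mean_sum => j.
  by apply: has_meanD; exact: quad_dev_moment.
- have sE i j : s (e i + e j) + s (e i - e j) = 2 * (Sigma i i + Sigma j j).
    by rewrite /s dotc_parallelogram !dotc_mulmx_delta.
  have Sii i : 0 <= Sigma i i by rewrite -dotc_mulmx_delta posdef_ge0.
  have Str i : Sigma i i <= \tr Sigma by rewrite /mxtrace (bigD1 i)//= lerDl sumr_ge0.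
  apply: (@le_trans _ _ (\sum_(i < p) \sum_(j < p) (32 * n%:R * (\tr Sigma) ^+ 2))).
    apply: ler_sum => i _; apply: ler_sum => j _.
    have := sE i j; rewrite -/(s _) -/(s _).
    have : 0 <= s (e i + e j) := posdef_ge0 _.
    have : 0 <= s (e i - e j) := posdef_ge0 _.
    move: (s _) (s _) => a b a0 b0 ab.
    have ab4 : a + b <= 4 * \tr Sigma.
      by have := Str i; have := Str j; lra.
    rewrite -mulrDr.
    (* The factor 32 is [2 * 4^2]: the variance constant 2 and the bound [a + b <= 4 tr Sigma], with
       [a^2 + b^2 <= (a + b)^2]. *)
    have -> : 32 * n%:R * \tr Sigma ^+ 2 = 2 * n%:R * (4 * \tr Sigma) ^+ 2 by ring.
    rewrite ler_wpM2l ?mulr_ge0//.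
    apply: (@le_trans _ _ ((a + b) ^+ 2)); first by nra.
    by rewrite ler_sqr// nnegrE; lra.
  rewrite !sumr_const !card_ord -mulrnA -[leLHS]mulr_natl natrM expr2.
  by rewrite le_eqVlt; apply/orP; left; apply/eqP; ring.
- move=> w v tau tau0 v1.
  pose K := (E w)^T *m E w - n%:R *: Sigma.
  have Ksym : K^T = K by rewrite /K linearB linearZ/= trmx_mul trmxK Spos.1.
  have KE t : quad_dev t w = dotc t (K *m t).
    by rewrite /quad_dev /K mulmxBl -scalemxAl dotcDr dotcNr dotcZr dotc_mulmxl mulmxA.
  rewrite -/(quad_dev v w) KE dotc_mulmx_expand.
  apply: le_trans (ler_norm_sum _ _ _) _.
  have -> : 2^-1 * (p%:R ^+ 2 * tau + W w / (8 * tau)) = \sum_(i < p) \sum_(j < p)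
     2^-1 * (tau + (quad_dev (e i + e j) w ^+ 2 + quad_dev (e i - e j) w ^+ 2) / (8 * tau)).
    under eq_bigr do rewrite -mulr_sumr big_split/= -mulr_suml sumr_const card_ord.
    rewrite -mulr_sumr big_split/= -mulr_suml sumr_const card_ord -/(W w).
    by congr (_ * (_ + _)); rewrite -mulrnA -[RHS]mulr_natl natrM expr2.
  apply: ler_sum => i _; apply: le_trans (ler_norm_sum _ _ _) _; apply: ler_sum => j _.
  apply: (@le_trans _ _ `|K i j|).
    by rewrite !normrM ler_piMl// mulr_ile1// dotc_coord_le1.
  have : 4 * K i j = quad_dev (e i + e j) w - quad_dev (e i - e j) w.
    by rewrite !KE (dotc_polarization Ksym) dotc_mulmx_delta.
  move: (quad_dev (e i + e j) w) (quad_dev (e i - e j) w) (K i j) => a b k kE.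
  (* AM-GM: [2 |k| <= tau + k^2 / tau] *)
  rewrite ler_pdivlMl//.
  have -> : tau + (a ^+ 2 + b ^+ 2) / (8 * tau) = (8 * tau ^+ 2 + (a ^+ 2 + b ^+ 2)) / (8 * tau).
    by field; rewrite gt_eqF.
  rewrite ler_pdivlMr ?mulr_gt0//.
  (* From [16 k^2 = (a - b)^2 <= 2 (a^2 + b^2)]. *)
  have k2 : 8 * `|k| ^+ 2 <= a ^+ 2 + b ^+ 2.
    rewrite real_normK ?num_real//.
    have -> : k = (a - b) / 4 by rewrite -kE; field.
    by have := sqr_ge0 (a + b); nra.
  by have := sqr_ge0 (`|k| - tau); nra.
Qed.

End gaussian_noise.

(** * Principal eigenvectors and the hat matrix *)

(** For unit vectors the smaller squared distance is [2 - 2 |g'v|], and [|g'v| <= 1] gives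
    [(g'v)^2 <= |g'v|]. *)
Lemma min_enorm_sqr_le (R : realType) (m : nat) (v g : 'cV[R]_m) :
  enorm v = 1 -> enorm g = 1 ->
  Num.min (enorm (1 *: v - g)) (enorm ((-1) *: v - g)) ^+ 2 <= 2 * (1 - dotc g v ^+ 2).
Proof.
move=> v1 g1.
have vv : dotc v v = 1 by rewrite -enorm_sqr v1 expr1n.
have gg : dotc g g = 1 by rewrite -enorm_sqr g1 expr1n.
have e0 (x : 'cV[R]_m) : 0 <= enorm x by exact: sqrtr_ge0.
have s1 : dotc g v ^+ 2 <= 1 by have := dotc_cauchy g v; rewrite vv gg mulr1.
have em : enorm (1 *: v - g) ^+ 2 = 2 - 2 * dotc g v.
  by rewrite enorm_sqr scale1r !dotcDl !dotcDr !dotcNl !dotcNr vv gg (dotcC v g); ring.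
have ep : enorm ((-1) *: v - g) ^+ 2 = 2 + 2 * dotc g v.
  by rewrite enorm_sqr scaleN1r !dotcDl !dotcDr !dotcNl !dotcNr vv gg (dotcC v g); ring.
have min0 : 0 <= Num.min (enorm (1 *: v - g)) (enorm ((-1) *: v - g)).
  by rewrite le_min !e0.
have [s0|s0] := leP 0 (dotc g v).
  apply: (@le_trans _ _ (enorm (1 *: v - g) ^+ 2)).
    by rewrite ler_sqr// ?nnegrE// ge_min lexx.
  by rewrite em; nra.
apply: (@le_trans _ _ (enorm ((-1) *: v - g) ^+ 2)).
  by rewrite ler_sqr// ?nnegrE// ge_min lexx orbT.
by rewrite ep; nra.
Qed.

Lemma principal_dotc_ge (R : realType) (m : nat) (S : 'M[R]_m) (v g : 'cV[R]_m) :
  S^T = S -> first_principal_eigenvector S v -> dotc g g = 1 ->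
  dotc g (S *m g) <= dotc v (S *m v).
Proof.
move=> Ssym [l [Sv v1] Sl] gg.
apply: le_trans (dotc_symmetric_le Ssym Sl g) _.
by rewrite gg Sv dotcZr -enorm_sqr v1 expr1n.
Qed.

(** Cauchy-Schwarz row by row; the right-hand side is the squared Frobenius norm of [M], summed over
    columns. *)
Lemma dotc_mulmx_frobenius (R : realType) (n m : nat) (M : 'M[R]_(n, m)) (x : 'cV[R]_m) :
  dotc x x = 1 ->
  dotc (M *m x) (M *m x) <= \sum_j dotc (M *m delta_mx j 0) (M *m delta_mx j 0).
Proof.
move=> x1; rewrite dotcE.
under [leRHS]eq_bigr do rewrite dotcE.
rewrite exchange_big; apply: ler_sum => k _ /=.
have rE (y : 'cV[R]_m) : (M *m y) k 0 = dotc (row k M)^T y.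
  by rewrite /dotc trmxK -row_mul [RHS]mxE.
rewrite rE -expr2; apply: le_trans (dotc_cauchy _ _) _.
rewrite x1 mulr1 dotcE; apply: ler_sum => j _.
by rewrite rE dotcC dotc_delta.
Qed.

(** If [u X'X = 0] then [|X u'|^2 = 0], and full column rank forces [u = 0]. *)
Lemma gram_unitmx (R : realType) (n q : nat) (X : 'M[R]_(n, q)) :
  \rank X = q -> X^T *m X \in unitmx.
Proof.
move=> rX; rewrite -row_free_unit; apply: inj_row_free => u uXX.
have Xu0 : X *m u^T = 0.
  have h : dotc (X *m u^T) (X *m u^T) = 0.
    by rewrite /dotc trmx_mul trmxK mulmxA -(mulmxA u) uXX mul0mx mxE.
  apply/colP => i; rewrite [RHS]mxE; apply/eqP; rewrite -sqrf_eq0; apply/eqP.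
  apply/eqP; rewrite eq_le sqr_ge0 andbT -h dotcE (bigD1 i)//= expr2 lerDl.
  by rewrite sumr_ge0// => j _; rewrite -expr2 sqr_ge0.
have fX : row_free X^T by rewrite /row_free mxrank_tr rX.
apply: (row_free_inj fX); rewrite mul0mx.
by apply: trmx_inj; rewrite trmx_mul trmxK Xu0 trmx0.
Qed.

Lemma dotc_projection (R : realType) (n p : nat) (M : 'M[R]_n) (Y : 'M[R]_(n, p)) x :
  M^T = M -> M *m M = M ->
  dotc x (Y^T *m M *m Y *m x) = dotc (M *m Y *m x) (M *m Y *m x).
Proof.
move=> Msym Midem; rewrite dotc_mulmxl trmx_mul Msym; congr dotc.
by rewrite -!mulmxA (mulmxA M M) Midem.
Qed.

Lemma dotc_proj_sqr (R : realType) (n : nat) (M : 'M[R]_n) (z : 'cV[R]_n) :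
  M^T = M -> M *m M = M -> dotc (M *m z) (M *m z) = dotc z (M *m z).
Proof. by move=> Msym Midem; rewrite dotc_mulmxl Msym mulmxA Midem. Qed.

Section hat_matrix.
Context {R : realType} {n q : nat}.
Variable X : 'M[R]_(n, q).
Hypotheses (rX : \rank X = q) (X1 : X^T *m ones R n = 0) (n0 : (0 < n)%N).
Let H := hat_mx X.
(** [J] averages, [H] projects onto the columns of [X], and [C] onto what remains: three orthogonal
    projections with sum the identity, as the columns of [X] are centered. *)
Let J : 'M[R]_n := n%:R^-1 *: (ones R n *m (ones R n)^T).
Let C := 1%:M - J - H.

Lemma tr_hat_mx : (hat_mx X)^T = hat_mx X.
Proof.
by rewrite /hat_mx !trmx_mul trmx_inv trmx_mul !trmxK mulmxA.
Qed.

Lemma hat_mx_mul : hat_mx X *m X = X.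
Proof. by rewrite /hat_mx -!mulmxA mulVmx ?mulmx1// gram_unitmx. Qed.

Lemma hat_mx_idem : hat_mx X *m hat_mx X = hat_mx X.
Proof. by rewrite {2}/hat_mx !mulmxA hat_mx_mul. Qed.

Lemma hat_mx_ones : hat_mx X *m ones R n = 0.
Proof. by rewrite /hat_mx -mulmxA X1 mulmx0. Qed.

Lemma mxtrace_hat_mx : \tr (hat_mx X) = q%:R.
Proof.
by rewrite /hat_mx mxtrace_mulC mulmxA mulmxV ?gram_unitmx// mxtrace1.
Qed.

Lemma ones_sqr : (ones R n)^T *m ones R n = n%:R%:M.
Proof.
apply/matrixP => i j; rewrite !ord1 mxE (eq_bigr (fun=> 1)); last first.
  by move=> k _; rewrite !mxE mulr1.
by rewrite sumr_const card_ord mxE.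
Qed.

Lemma mean_mx_ones : J *m ones R n = ones R n.
Proof.
rewrite /J -scalemxAl -mulmxA ones_sqr mul_mx_scalar scalerA mulVf ?scale1r//.
by rewrite pnatr_eq0 -lt0n.
Qed.

Lemma tr_mean_mx : J^T = J.
Proof. by rewrite /J linearZ/= trmx_mul trmxK. Qed.

Lemma mean_mx_idem : J *m J = J.
Proof. by rewrite {2}/J -scalemxAr mulmxA mean_mx_ones. Qed.

Lemma mean_hat_mx0 : J *m H = 0.
Proof.
apply: trmx_inj; rewrite trmx_mul tr_hat_mx tr_mean_mx trmx0.
by rewrite /J -scalemxAr mulmxA hat_mx_ones mul0mx scaler0.
Qed.

Lemma tr_resid_mx : C^T = C.
Proof. by rewrite /C !linearB/= trmx1 tr_mean_mx tr_hat_mx. Qed.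

Lemma hat_mean_mx0 : H *m J = 0.
Proof. by rewrite /J -scalemxAr mulmxA hat_mx_ones mul0mx scaler0. Qed.

Lemma resid_mx_idem : C *m C = C.
Proof.
rewrite /C !mulmxBr !mulmxBl !mulmx1 !mul1mx mean_mx_idem hat_mx_idem.
by rewrite mean_hat_mx0 hat_mean_mx0 !subr0 !subrr !subr0.
Qed.

Lemma resid_mx_ones : C *m ones R n = 0.
Proof. by rewrite /C !mulmxBl mul1mx mean_mx_ones hat_mx_ones subrr subr0. Qed.

Lemma resid_mx_mul : C *m X = 0.
Proof.
rewrite /C !mulmxBl mul1mx hat_mx_mul.
have -> : J *m X = 0; last by rewrite subr0 subrr.
apply: trmx_inj; rewrite trmx_mul tr_mean_mx trmx0.
by rewrite /J -scalemxAr mulmxA X1 mul0mx scaler0.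
Qed.

(** * Quadratic forms of [S_R] and [S_E] in terms of the noise *)

Section forms.
Context {p : nat}.
Variables (mu g : 'cV[R]_p) (alpha : 'cV[R]_q) (E : 'M[R]_(n, p)).
Let Y := allometric_obs X mu alpha g E.

Lemma tr_S_w w : (S_w X Y w)^T = S_w X Y w.
Proof.
have symM (M : 'M[R]_n) : M^T = M -> (Y^T *m M *m Y)^T = Y^T *m M *m Y.
  by move=> Msym; rewrite !trmx_mul trmxK Msym mulmxA.
rewrite /S_w linearD !linearZ/= symM; last exact: tr_hat_mx.
by rewrite symM//; exact: tr_resid_mx.
Qed.

(** This is where [mu] disappears: both [H] and [C] annihilate [ones]. *)
Lemma mulmx_obs (M : 'M[R]_n) x : M *m ones R n = 0 ->
  M *m Y *m x = dotc g x *: (M *m X *m alpha) + M *m E *m x.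
Proof.
move=> M1; rewrite /Y /allometric_obs !mulmxDr !mulmxDl !mulmxA M1 !mul0mx add0r.
congr (_ + _).
by rewrite -(mulmxA _ g^T) [g^T *m x]mx11_scalar mul_mx_scalar.
Qed.

Lemma dotc_S_R x : dotc x (S_R X Y *m x) =
  enorm (X *m alpha) ^+ 2 * dotc g x ^+ 2
  + 2 * dotc g x * dotc (X *m alpha) (E *m x) + dotc (H *m E *m x) (H *m E *m x).
Proof.
have HY : H *m Y *m x = dotc g x *: (X *m alpha) + H *m E *m x.
  by rewrite (mulmx_obs _ hat_mx_ones) hat_mx_mul.
have -> : dotc x (S_R X Y *m x) = dotc (H *m Y *m x) (H *m Y *m x).
  by apply: dotc_projection; [exact: tr_hat_mx | exact: hat_mx_idem].
rewrite HY dotcDl !dotcDr !dotcZl !dotcZr -enorm_sqr.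
have XH : dotc (X *m alpha) (H *m E *m x) = dotc (X *m alpha) (E *m x).
  have := dotc_mulmxl H (E *m x) (X *m alpha).
  by rewrite tr_hat_mx !mulmxA hat_mx_mul dotcC => ->; rewrite dotcC.
by rewrite (dotcC (H *m E *m x) (X *m alpha)) XH; ring.
Qed.

(** [C] annihilates [X] as well, so the signal contributes nothing. *)
Lemma dotc_S_E x : dotc x (S_E X Y *m x) = dotc (E *m x) (C *m E *m x).
Proof.
have CY : C *m Y *m x = C *m E *m x.
  by rewrite (mulmx_obs _ resid_mx_ones) resid_mx_mul mul0mx scaler0 add0r.
have -> : dotc x (S_E X Y *m x) = dotc (C *m Y *m x) (C *m Y *m x).
  by apply: dotc_projection; [exact: tr_resid_mx | exact: resid_mx_idem].
by rewrite CY -(mulmxA C) dotc_proj_sqr//; [exact: tr_resid_mx | exact: resid_mx_idem].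
Qed.

Lemma dotc_resid_bounds x :
  0 <= dotc (E *m x) (C *m E *m x) <= dotc (E *m x) (E *m x).
Proof.
have CC (z : 'cV[R]_n) : dotc z (C *m z) = dotc (C *m z) (C *m z).
  by rewrite dotc_proj_sqr//; [exact: tr_resid_mx | exact: resid_mx_idem].
rewrite -(mulmxA C); apply/andP; split; first by rewrite CC dotc_ge0.
rewrite -subr_ge0; have := dotc_ge0 (E *m x - C *m (E *m x)).
rewrite !dotcDl !dotcDr !dotcNl !dotcNr -CC (dotcC (C *m _)).
by move: (dotc _ _) (dotc _ _) => a b; lra.
Qed.

(** Since [H + C = 1 - J], equal weights recombine the two pieces into the centered scatter of
    [E]. *)
Lemma dotc_hat_resid x : dotc (H *m E *m x) (H *m E *m x) + dotc (E *m x) (C *m E *m x) =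
  dotc (E *m x) (E *m x) - n%:R^-1 * dotc (ones R n) (E *m x) ^+ 2.
Proof.
rewrite -!(mulmxA _ E x); move: (E *m x) => z.
have -> : dotc (H *m z) (H *m z) = dotc z (H *m z).
  by apply: dotc_proj_sqr; [exact: tr_hat_mx | exact: hat_mx_idem].
rewrite -dotcDr -mulmxDl; have -> : H + C = 1%:M - J by rewrite /C addrC subrK.
rewrite mulmxBl mul1mx dotcDr dotcNr; congr (_ - _).
rewrite /J -scalemxAl dotcZr -mulmxA [(ones R n)^T *m z]mx11_scalar mul_mx_scalar.
by rewrite dotcZr dotcC expr2.
Qed.

End forms.
End hat_matrix.

(** * Error probabilities for a fixed sample size *)

Section one_model.
Context {R : realType} {d : measure_display} {T : measurableType d}.
Variables (P : probability T R) (n p q : nat) (X : 'M[R]_(n, q)) (mu : 'cV[R]_p)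
  (alpha : 'cV[R]_q) (Sigma : 'M[R]_p) (lam : nat -> R) (g : 'cV[R]_p)
  (E : T -> 'M[R]_(n, p)) (w : R) (v : T -> 'cV[R]_p).
Hypotheses (n0 : (0 < n)%N) (p1 : (1 < p)%N).
Hypothesis model : allometric_model P X Sigma lam g E.
Hypothesis hv : forall o, first_principal_eigenvector
  (S_w X (allometric_obs X mu alpha g (E o)) w) (v o).
Hypothesis vmeas : forall i : 'I_p, measurable_fun [set: T] (fun o => v o i 0).

Let Z o := Num.min (enorm (1 *: v o - g)) (enorm ((-1) *: v o - g)).

Let rX := am_rank model.
Let X1 := am_centered model.
Let Spos := am_posdef model.

Lemma measurable_error : measurable_fun [set: T] Z.
Proof.
have me c : measurable_fun [set: T] (fun o => enorm (c *: v o - g)).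
  apply: (@measurableT_comp _ _ _ _ _ _ (@Num.sqrt R)); first by apply: continuous_measurable_fun; exact: sqrt_continuous.
  apply: measurable_sum => i; apply: measurable_funX.
  under eq_fun do rewrite !mxE.
  apply: measurable_funD; last exact: measurable_cst.
  by apply: measurable_funM => //; exact: measurable_cst.
exact: measurable_minr.
Qed.

Lemma error_ge0 o : 0 <= Z o.
Proof. by rewrite le_min !sqrtr_ge0. Qed.

Let gg : dotc g g = 1.
Proof. by have [_ g1] := am_gamma1 model; rewrite -enorm_sqr g1 expr1n. Qed.

Let vv o : dotc (v o) (v o) = 1.
Proof. by have [l [_ v1] _] := hv o; rewrite -enorm_sqr v1 expr1n. Qed.

Lemma error_sqr_le o : Z o ^+ 2 <= 2 * (1 - dotc g (v o) ^+ 2).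
Proof.
have [l [_ v1] _] := hv o; have [_ g1] := am_gamma1 model.
exact: min_enorm_sqr_le.
Qed.

Let gv1 o : dotc g (v o) ^+ 2 <= 1.
Proof. by have := dotc_cauchy g (v o); rewrite gg vv mulr1. Qed.

Let Y o := allometric_obs X mu alpha g (E o).

(** Maximality of the estimated eigenvector enters both probability bounds through this comparison
    with [g]. *)
Lemma principal_S_w o :
  (1 - w) * dotc g (S_R X (Y o) *m g) + w * dotc g (S_E X (Y o) *m g) <=
  (1 - w) * dotc (v o) (S_R X (Y o) *m v o) + w * dotc (v o) (S_E X (Y o) *m v o).
Proof.
have := principal_dotc_ge (tr_S_w X mu g alpha (E o) w) (hv o) gg.
by rewrite /S_w !mulmxDl -!scalemxAl !dotcDr !dotcZr.
Qed.

(** A possibly random direction [y] is replaced by the [p] fixed basis directions, whose moments are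
    known. *)
Let lin_bound (x : 'cV[R]_n) o (y : 'cV[R]_p) : dotc y y = 1 ->
  `|dotc x (E o *m y)| <= \sum_j `|dotc x (E o *m delta_mx j 0)|.
Proof.
move=> y1.
have -> : dotc x (E o *m y) = \sum_j y j 0 * dotc x (E o *m delta_mx j 0).
  have -> : dotc x (E o *m y) = dotc ((E o)^T *m x) y by rewrite dotc_mulmxl trmxK.
  rewrite dotcE; apply: eq_bigr => j _; rewrite mulrC; congr (_ * _).
  by rewrite -dotc_delta dotcC dotc_mulmxl trmxK.
apply: le_trans (ler_norm_sum _ _ _) _; apply: ler_sum => j _.
by rewrite normrM ler_piMl// dotc_coord_le1.
Qed.

(** In the comparison of [g] with [v], the signal leaves [c (1 - (g'v)^2)] against noise terms.
    These are dominated by sums of squares of fixed linear forms of [E], and Markov's inequality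
    applies. *)
Lemma error_prob_signal (eps tau : R) : 0 < eps -> 0 < tau -> 0 <= w <= 2^-1 ->
  forall c, c = enorm (X *m alpha) ^+ 2 -> 0 < c ->
  (P [set o | (eps < `|Z o - 0|)%R] <=
   (2 / c * (2 * p%:R * tau + 2 * (c * \tr Sigma) / tau + q%:R * \tr Sigma
     + 2 * w * (n%:R * \tr Sigma)) / eps ^+ 2)%:E)%E.
Proof.
move=> eps0 tau0 /andP[w0 w2] c cE c0.
pose xi j o := dotc (X *m alpha) (E o *m delta_mx j 0).
(* [FH] and [F] are the squared Frobenius norms of [HE] and [E], written entrywise as linear forms
   so that [mom] applies. *)
pose FH o := \sum_(j < p) \sum_(k < n)
  dotc (hat_mx X *m delta_mx k 0) (E o *m delta_mx j 0) ^+ 2.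
pose F o := \sum_(j < p) \sum_(k < n)
  dotc (delta_mx k 0) (E o *m delta_mx j 0) ^+ 2.
pose U o := 2 / c * (2 * p%:R * tau + 2 / tau * (\sum_(j < p) xi j o ^+ 2) + FH o + 2 * w * F o).
have mom x j : has_mean P (fun o => dotc x (E o *m delta_mx j 0) ^+ 2) (dotc x x * Sigma j j).
  have [h _] := bilinear_moments Spos (am_error model) x (delta_mx j 0).
  by apply: has_mean_ext h _ _ => //; rewrite dotc_mulmx_delta.
have mxi : has_mean P (fun o => \sum_(j < p) xi j o ^+ 2) (c * \tr Sigma).
  apply: has_mean_ext (has_mean_sum _ (fun j => mom (X *m alpha) j)) _ _ => //.
  by rewrite cE enorm_sqr mulr_sumr.
have mF : has_mean P F (n%:R * \tr Sigma).
  apply: has_mean_ext (has_mean_sum _ (fun j => has_mean_sum (index_enum 'I_n)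
    (fun k => mom (delta_mx k 0) j))) _ _ => //.
  rewrite /mxtrace mulr_sumr; apply: eq_bigr => j _.
  rewrite -mulr_suml (eq_bigr (fun=> 1)) ?sumr_const ?card_ord// => k _.
  by rewrite dotc_delta mxE !eqxx.
(* The factor [q] is the trace of the projection [H]; without the projection it would be [n]. *)
have mFH : has_mean P FH (q%:R * \tr Sigma).
  apply: has_mean_ext (has_mean_sum _ (fun j => has_mean_sum (index_enum 'I_n)
    (fun k => mom (hat_mx X *m delta_mx k 0) j))) _ _ => //.
  rewrite /mxtrace mulr_sumr; apply: eq_bigr => j _.
  rewrite -mulr_suml -(mxtrace_hat_mx rX); congr (_ * _); apply: eq_bigr => k _.
  rewrite dotc_proj_sqr; [|exact: tr_hat_mx|exact: hat_mx_idem].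
  by rewrite dotc_mulmx_delta.
have mU := has_meanZ (2 / c) (has_meanD (has_meanD (has_meanD
  (has_mean_cst P (2 * p%:R * tau)) (has_meanZ (2 / tau) mxi)) mFH) (has_meanZ (2 * w) mF)).
have ZU o : Z o ^+ 2 <= U o.
  apply: le_trans (error_sqr_le o) _.
  rewrite /U -[2 / c * _]mulrA ler_wpM2l// mulrC ler_pdivlMr// mulrC.
  have := principal_S_w o.
  rewrite !(dotc_S_R rX X1) !(dotc_S_E rX X1 n0) gg -cE.
  have HEg0 := dotc_ge0 (hat_mx X *m E o *m g).
  have /andP[CEg0 _] := dotc_resid_bounds rX X1 n0 (E o) g.
  have /andP[_] := dotc_resid_bounds rX X1 n0 (E o) (v o).
  have HEF : dotc (hat_mx X *m E o *m v o) (hat_mx X *m E o *m v o) <= FH o.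
    apply: le_trans (dotc_mulmx_frobenius _ (vv o)) _; rewrite le_eqVlt; apply/orP; left.
    apply/eqP; apply: eq_bigr => j _; rewrite dotcE; apply: eq_bigr => k _.
    by rewrite -expr2 dotc_mulmxl tr_hat_mx mulmxA dotc_delta.
  have EF : dotc (E o *m v o) (E o *m v o) <= F o.
    apply: le_trans (dotc_mulmx_frobenius _ (vv o)) _; rewrite le_eqVlt; apply/orP; left.
    apply/eqP; apply: eq_bigr => j _; rewrite dotcE; apply: eq_bigr => k _.
    by rewrite -expr2 dotc_delta.
  pose S := \sum_(j < p) `|xi j o|.
  have a1S : `|dotc (X *m alpha) (E o *m g)| <= S by exact: lin_bound.
  have a2S : `|dotc (X *m alpha) (E o *m v o)| <= S by exact: lin_bound.
  (* AM-GM: [2 |xi| <= tau + xi^2 / tau] *)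
  have S4 : 4 * S <= 2 * p%:R * tau + 2 / tau * \sum_(j < p) xi j o ^+ 2.
    have -> : 2 * p%:R * tau + 2 / tau * (\sum_(j < p) xi j o ^+ 2) =
        \sum_(j < p) (2 * tau + 2 / tau * xi j o ^+ 2).
      rewrite big_split/= -!mulr_sumr sumr_const card_ord -(mulr_natl tau p).
      by congr (_ + _); ring.
    rewrite mulr_sumr; apply: ler_sum => j _.
    have -> : 2 * tau + 2 / tau * xi j o ^+ 2 = (2 * tau ^+ 2 + 2 * `|xi j o| ^+ 2) / tau.
      by rewrite real_normK ?num_real//; field; rewrite gt_eqF.
    rewrite ler_pdivlMr//.
    by have := sqr_ge0 (tau - `|xi j o|); nra.
  have s2 := gv1 o.
  have s1 : `|dotc g (v o)| <= 1.
    by rewrite -(@expr_le1 _ 2)// real_normK ?num_real.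
  have sa2 : dotc g (v o) * dotc (X *m alpha) (E o *m v o) <= S.
    apply: le_trans (ler_norm _) _; rewrite normrM; apply: le_trans a2S.
    by rewrite ler_piMl.
  move: a1S; rewrite ler_norml => /andP[a1S _].
  move: (dotc (X *m alpha) (E o *m g)) a1S => a1 a1S.
  move: (dotc (X *m alpha) (E o *m v o)) sa2 {a2S} => a2 sa2.
  move: (dotc (hat_mx X *m E o *m v o) _) HEF => HEv HEF.
  move: (dotc (hat_mx X *m E o *m g) _) HEg0 => HEg HEg0.
  move: (dotc (E o *m v o) (E o *m v o)) EF => Ev EF.
  move: (dotc (E o *m v o) _) (dotc (E o *m g) _) CEg0 => CEv CEg CEg0 CEvF.
  have F0 : 0 <= F o by rewrite sumr_ge0// => j _; rewrite sumr_ge0// => k _; rewrite sqr_ge0.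
  move: (F o) (FH o) (\sum_(j < p) xi j o ^+ 2) S4 F0 HEF EF => f fh q2 S4 F0 HEF EF.
  move: (dotc g (v o)) S sa2 a1S s2 S4 {s1} => s S sa2 a1S s2 S4 h.
  have w1 : 0 < 1 - w by lra.
  (* The goal is multiplied by [1 - w], the weight of [S_R]. *)
  rewrite -subr_ge0 -(pmulr_rge0 _ w1).
  have h1 : (1 - w) * (c * (1 - s ^+ 2)) <= (1 - w) * (4 * S + fh) + w * f.
    have e1 : w * CEv <= w * f by rewrite ler_wpM2l//; lra.
    have e2 : 0 <= w * CEg by rewrite mulr_ge0.
    have e3 : (1 - w) * (2 * s * a2 + HEv - 2 * a1 - HEg) <= (1 - w) * (4 * S + fh).
      by rewrite ler_pM2l//; lra.
    by lra.
  (* Here [w <= 1/2] is used, in the form [1 <= 2 (1 - w)]. *)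
  have h2 : w * f <= (1 - w) * (2 * w * f).
    have : 0 <= w * f * (1 - 2 * w) by rewrite !mulr_ge0//; lra.
    by lra.
  have h3 : (1 - w) * (4 * S) <= (1 - w) * (2 * p%:R * tau + 2 / tau * q2).
    by rewrite ler_pM2l.
  move: h1 h2 h3; move: (2 / tau * q2) (2 * p%:R * tau) => y z.
  by lra.
have := prob_gt_le_mean eps0 measurable_error error_ge0 ZU mU.
move/le_trans; apply; rewrite lee_fin le_eqVlt; apply/orP; left; apply/eqP.
by congr (_ * (_ + _ + _ + _) / _); rewrite mulrAC.
Qed.

(** The spectral gap makes [n (g' Sigma g - v' Sigma v)] at least [n (lam 1 - lam 2) (1 - (g'v)^2)].
    The concentration bound is used twice, at [g] and at [v], which cancels its factor [1/2]. *)
Lemma error_prob_gap (eps tau : R) : 0 < eps -> 0 < tau -> w = 2^-1 -> alpha = 0 ->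
  (P [set o | (eps < `|Z o - 0|)%R] <=
   (2 / (n%:R * (lam 1%N - lam 2%N)) * (p%:R ^+ 2 * tau +
     32 * p%:R ^+ 2 * n%:R * (\tr Sigma) ^+ 2 / (8 * tau) + lam 1%N) / eps ^+ 2)%:E)%E.
Proof.
move=> eps0 tau0 w2 a0.
have [W [r [mW rle WP]]] := quadratic_form_concentration Spos (am_error model).
have [Sg g1] := am_gamma1 model.
have d0 : 0 < lam 1%N - lam 2%N by rewrite subr_gt0 (am_gap model).
have nd0 : 0 < n%:R * (lam 1%N - lam 2%N) by rewrite mulr_gt0// ltr0n.
have m1 : has_mean P (fun o => dotc (ones R n) (E o *m g) ^+ 2) (n%:R * lam 1%N).
  have [h _] := bilinear_moments Spos (am_error model) (ones R n) g.
  apply: has_mean_ext h _ _ => //.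
  by rewrite Sg dotcZr gg mulr1 /dotc ones_sqr mxE eqxx.
have mU := has_meanZ (2 / (n%:R * (lam 1%N - lam 2%N)))
  (has_meanD (has_meanD (has_mean_cst P (p%:R ^+ 2 * tau)) (has_meanZ (8 * tau)^-1 mW))
    (has_meanZ n%:R^-1 m1)).
have ZU o : Z o ^+ 2 <= 2 / (n%:R * (lam 1%N - lam 2%N)) * (p%:R ^+ 2 * tau +
    (8 * tau)^-1 * W o + n%:R^-1 * dotc (ones R n) (E o *m g) ^+ 2).
  apply: le_trans (error_sqr_le o) _.
  rewrite -mulrA ler_wpM2l// mulrC ler_pdivlMr// mulrC.
  have := principal_S_w o; rewrite w2.
  have -> : 1 - 2^-1 = 2^-1 :> R by field.
  rewrite -!mulrDr ler_pM2l ?invr_gt0//.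
  rewrite !(dotc_S_R rX X1) !(dotc_S_E rX X1 n0) a0 mulmx0.
  have en0 : enorm (0 : 'cV[R]_n) ^+ 2 = 0 by rewrite enorm_sqr /dotc mulmx0 mxE.
  have d0l (y : 'cV[R]_n) : dotc 0 y = 0 by rewrite /dotc trmx0 mul0mx mxE.
  rewrite en0 !d0l !mul0r !mulr0 !add0r !dotc_hat_resid//.
  have := WP o g tau tau0 gg; rewrite Sg dotcZr gg mulr1.
  have := WP o (v o) tau tau0 (vv o).
  have := dotc_spectral_gap p1 Spos.1 (am_eigenvalues model) (am_gap model) (am_gamma1 model) (v o).
  rewrite (vv o) !ler_norml => gapv.
  have nR : 0 < n%:R :> R by rewrite ltr0n.
  (* The centering term at [v] has a favorable sign and is dropped; the one at [g] stays, with mean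
     [lam 1]. *)
  have Jv : 0 <= n%:R^-1 * dotc (ones R n) (E o *m v o) ^+ 2.
    by rewrite mulr_ge0 ?invr_ge0 ?sqr_ge0// ltW.
  have {}gapv := ler_wpM2l (ltW nR) gapv; move: gapv.
  rewrite [(8 * tau)^-1 * _]mulrC.
  move: (n%:R^-1 * dotc (ones R n) (E o *m v o) ^+ 2) Jv => J0 J0p.
  move: (n%:R^-1 * dotc (ones R n) (E o *m g) ^+ 2) => J1.
  move: (W o / (8 * tau)) (p%:R ^+ 2 * tau) => y z.
  move: (dotc (E o *m v o) _) (dotc (E o *m g) _) (dotc (v o) _) => Ev Eg vSv.
  move: (dotc g (v o)) => s gapv /andP[_ N1] /andP[N2 _] h.
  by lra.
have := prob_gt_le_mean eps0 measurable_error error_ge0 ZU mU.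
move/le_trans; apply; rewrite lee_fin ler_pM2r ?invr_gt0 ?exprn_gt0//.
rewrite ler_pM2l ?divr_gt0//; apply: lerD.
  by rewrite lerD2l mulrC ler_pM2r// invr_gt0 mulr_gt0.
by rewrite mulKf// pnatr_eq0 -lt0n.
Qed.

End one_model.

(** * Rates *)

Lemma limn_esup_lt_near (R : realType) (u : nat -> \bar R) (x : \bar R) :
  (limn_esup u < x)%E -> \forall n \near \oo, (u n < x)%E.
Proof.
move=> /ereal_inf_lt[_ [V Voo <-] supV]; near=> n.
apply: le_lt_trans supV; apply: ereal_sup_ubound; exists n => //.
by near: n.
Unshelve. all: by end_near. Qed.

(** The lower limit is minus the upper limit of the opposite sequence; [k] is half of it, or 1 if it
    is infinite. *)
Lemma Theta_pow_ge (R : realType) (a : nat -> R) (u : R) : Theta_pow a u ->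
  exists2 k : R, 0 < k & \forall n \near \oo, k * n%:R `^ u <= a n.
Proof.
move=> [+ _]; rewrite /limn_einf => h.
have [k k0 kh] : exists2 k : R, 0 < k &
    (limn_esup (\- (fun n => (a n / n%:R `^ u)%:E)) < (- k)%:E)%E.
  move: h; rewrite oppe_gt0; case: (limn_esup _) => [r|//|_]; last by exists 1; rewrite ?ltNyr.
  by rewrite lte_fin => r0; exists (- r / 2); rewrite ?lte_fin; lra.
exists k => //; near=> n.
have n0 : (0 : R) < n%:R by rewrite ltr0n; near: n; exact: nbhs_infty_gt.
have : (- (a n / n%:R `^ u)%:E < (- k)%:E)%E by near: n; exact: limn_esup_lt_near kh.
by rewrite -EFinN lte_fin ltrN2 ltr_pdivlMr ?powR_gt0// => /ltW.
Unshelve. all: by end_near. Qed.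

Lemma Theta_pow_le (R : realType) (a : nat -> R) (u : R) : Theta_pow a u ->
  exists2 k : R, 0 < k & \forall n \near \oo, a n <= k * n%:R `^ u.
Proof.
move=> [_ h].
have [k k0 kh] : exists2 k : R, 0 < k &
    (limn_esup (fun n => (a n / n%:R `^ u)%:E) < k%:E)%E.
  move: h; case: (limn_esup _) => [r _|//|_]; last by exists 1; rewrite ?ltNyr.
  exists (`|r| + 1); first by rewrite ltr_wpDl.
  by rewrite lte_fin (le_lt_trans (ler_norm r))// ltrDl.
exists k => //; near=> n.
have n0 : (0 : R) < n%:R by rewrite ltr0n; near: n; exact: nbhs_infty_gt.
have : ((a n / n%:R `^ u)%:E < k%:E)%E by near: n; exact: limn_esup_lt_near kh.
by rewrite lte_fin ltr_pdivrMr ?powR_gt0// => /ltW.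
Unshelve. all: by end_near. Qed.

Lemma cvg_powRN (R : realType) (u : R) : 0 < u ->
  (fun n : nat => n%:R `^ (- u) : R) @ \oo --> (0 : R).
Proof.
move=> u0.
have inv0 : (fun n : nat => n%:R^-1 : R) @ \oo --> (0 : R).
  apply/gtr0_cvgV0; last exact: cvgr_idn.
  by near=> n; rewrite ltr0n; near: n; exact: nbhs_infty_gt.
have inv0r : (fun n : nat => n%:R^-1 : R) @ \oo --> 0^'+.
  move=> A hA; apply: filterS2 (nbhs_infty_gt 0) (inv0 _ hA) => n n0; apply.
  by rewrite invr_gt0 ltr0n.
have := cvg_comp _ _ inv0r (powR_cvg0 u0); apply: cvg_trans.
apply: near_eq_cvg; near=> n.
by rewrite /= -powR_inv1// -powRrM mulN1r.
Unshelve. all: by end_near. Qed.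

Lemma cvg_dotc_mulmx (R : realType) (q : nat) (A : nat -> 'M[R]_q) (Q : 'M[R]_q)
    (x : 'cV[R]_q) : A @ \oo --> Q ->
  (fun n => dotc x (A n *m x)) @ \oo --> dotc x (Q *m x).
Proof.
move=> AQ; under eq_cvg do rewrite dotc_mulmx_expand.
rewrite dotc_mulmx_expand; apply: cvg_big => //; first exact: add_continuous.
move=> i _; apply: cvg_big => //; first exact: add_continuous.
move=> j _.
apply: cvgM; first exact: cvg_cst.
by apply: (cvg_comp A (fun M : 'M[R]_q => M i j) AQ); exact: coord_continuous.
Qed.

Lemma cvg_in_probability_rate (R : realType) (d : nat -> measure_display)
    (T : forall n, measurableType (d n)) (P : forall n, probability (T n) R)
    (Z : forall n, T n -> R) (rate : nat -> R) : rate @ \oo --> (0 : R) ->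
  (forall eps, 0 < eps -> \forall n \near \oo,
    (P n [set w | (eps < `|Z n w - 0|)%R] <= (rate n / eps ^+ 2)%:E)%E) ->
  cvg_in_probability P Z 0.
Proof.
move=> rate0 h eps eps0.
apply: (@squeeze_cvge _ _ _ _ (fun=> 0%E) _ (fun n => (rate n / eps ^+ 2)%:E)).
- by apply: filterS (h eps eps0) => n ->; rewrite andbT measure_ge0.
- exact: cvg_cst.
- apply: cvg_EFin; first exact: nearW.
  rewrite -(mul0r (eps ^- 2)); apply: cvgM => //; exact: cvg_cst.
Qed.

(** Keeping only [a c] in the denominator bounds the weight by [d (q / c + 2 b / a)], so it is of
    the order of the gap. *)
Lemma w_star_bounds (R : realType) (n p q : nat) (X : 'M[R]_(n, q)) (alpha : 'cV[R]_q)
    (Sigma : 'M[R]_p) (lam : nat -> R) (kap s0 B : R) :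
  0 < kap -> kap <= enorm (X *m alpha) ^+ 2 ->
  0 < s0 -> s0 <= \tr (Sigma *m Sigma) ->
  0 <= lam 1%N + \tr Sigma <= B -> 0 <= lam 1%N - lam 2%N ->
  0 <= w_star X alpha Sigma lam <=
    (lam 1%N - lam 2%N) * (q%:R / kap + 2 * B / s0).
Proof.
move=> kap0; rewrite /w_star; set b := lam 1%N + _; set d := lam 1%N - _.
move: (enorm (X *m alpha) ^+ 2) => c kc s00 s0le /andP[b0 bB] d0.
set a := _ + _ ^+ 2.
have sa : s0 <= a by rewrite (le_trans s0le)// lerDl sqr_ge0.
have a0 : 0 < a by exact: lt_le_trans sa.
have c0 : 0 < c by exact: lt_le_trans kc.
have q0 : 0 <= q%:R :> R by [].
have N0 : 0 <= a * d * q%:R by rewrite !mulr_ge0// ltW.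
have N1 : 0 <= 2 * b * c * d by rewrite !mulr_ge0// ltW.
have ac0 : 0 < a * c by rewrite mulr_gt0.
have den0 : 0 < 2 * a * d * q%:R + 2 * b * c * d + a * c by lra.
apply/andP; split; first by apply: divr_ge0; [exact: addr_ge0 | exact: ltW].
apply: (@le_trans _ _ ((a * d * q%:R + 2 * b * c * d) / (a * c))).
  rewrite ler_wpM2l ?addr_ge0// lef_pV2 ?posrE//; lra.
have -> : (a * d * q%:R + 2 * b * c * d) / (a * c) = d * (q%:R / c + 2 * b / a).
  by field; rewrite !gt_eqF.
rewrite ler_wpM2l// lerD//.
  by rewrite ler_wpM2l// lef_pV2.
apply: ler_pM; rewrite ?mulr_ge0 ?invr_ge0 ?(ltW a0)//; first by rewrite ler_pM2l.
by rewrite lef_pV2.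
Qed.

(** The choice [tau = sqrt n] balances the first two terms when [c] grows like [n]. The last term is
    of the order of [w], and [r] stands for [n^(-eta)]. *)
Lemma signal_rate (R : realFieldType) (p q n t t1 kap c tau w D r : R) :
  n = tau ^+ 2 -> 1 <= tau -> 0 < kap -> kap * n <= c -> 0 <= t <= t1 ->
  0 <= w <= D * r -> 0 <= p -> 0 <= q ->
  2 / c * (2 * p * tau + 2 * (c * t) / tau + q * t + 2 * w * (n * t)) <=
  (4 * p / kap + 4 * t1 + 2 * q * t1 / kap) * tau^-1 + 4 * t1 * D / kap * r.
Proof.
move=> nE tau1 kap0 kc /andP[t0 tt1] /andP[w0 wD] p0 q0.
have tau0 : 0 < tau by lra.
have n0 : 0 < n by rewrite nE exprn_gt0.
have c0 : 0 < c by apply: lt_le_trans kc; rewrite mulr_gt0.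
have -> : 2 / c * (2 * p * tau + 2 * (c * t) / tau + q * t + 2 * w * (n * t)) =
  4 * p * tau / c + 4 * t / tau + 2 * q * t / c + 4 * (w * t) * n / c.
  by field; rewrite !gt_eqF.
have cV : c^-1 <= (kap * n)^-1 by rewrite lef_pV2 ?posrE// mulr_gt0.
have yV : tau^-1 <= 1 by rewrite invf_le1.
have h1 : 4 * p * tau / c <= 4 * p / kap * tau^-1.
  have -> : 4 * p / kap * tau^-1 = 4 * p * tau / (kap * n).
    by rewrite nE; field; rewrite !gt_eqF.
  by rewrite ler_wpM2l// !mulr_ge0// ltW.
have h2 : 4 * t / tau <= 4 * t1 * tau^-1.
  by rewrite ler_pM2r ?invr_gt0// ler_pM2l.
have h3 : 2 * q * t / c <= 2 * q * t1 / kap * tau^-1.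
  apply: (@le_trans _ _ (2 * q * t1 / (kap * n))).
    by apply: ler_pM; rewrite ?mulr_ge0 ?invr_ge0 ?(ltW c0)// ler_wpM2l ?mulr_ge0.
  have -> : 2 * q * t1 / (kap * n) = 2 * q * t1 / kap * tau^-1 * tau^-1.
    by rewrite nE; field; rewrite !gt_eqF.
  rewrite ler_piMr// !mulr_ge0 ?invr_ge0 ?(ltW kap0) ?(ltW tau0)//.
  exact: le_trans tt1.
have h4 : 4 * (w * t) * n / c <= 4 * t1 * D / kap * r.
  apply: (@le_trans _ _ (4 * (w * t) * n / (kap * n))).
    by rewrite ler_wpM2l// !mulr_ge0// ltW.
  have -> : 4 * (w * t) * n / (kap * n) = 4 / kap * (w * t) by field; rewrite !gt_eqF.
  have -> : 4 * t1 * D / kap * r = 4 / kap * (D * r * t1) by field; rewrite gt_eqF.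
  by rewrite ler_pM2l ?divr_gt0//; exact: ler_pM.
rewrite mulrDl mulrDl; lra.
Qed.

(** With [tau = sqrt n] the bracket is of order [sqrt n]; dividing by [n d], with [e] standing for
    [n^(-eta)], leaves [1 / (e sqrt n)]. *)
Lemma gap_rate (R : realFieldType) (p n t t1 l L d k e tau : R) :
  n = tau ^+ 2 -> 1 <= tau -> 0 < k -> 0 < e -> k * e <= d -> 0 <= t <= t1 -> l <= L ->
  0 <= L -> 0 <= p ->
  2 / (n * d) * (p ^+ 2 * tau + 32 * p ^+ 2 * n * t ^+ 2 / (8 * tau) + l) <=
  2 / k * (p ^+ 2 + 4 * p ^+ 2 * t1 ^+ 2 + L) * (e * tau)^-1.
Proof.
move=> nE tau1 k0 e0 ked /andP[t0 tt1] lL L0 p0.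
have tau0 : 0 < tau by lra.
have n0 : 0 < n by rewrite nE exprn_gt0.
have ke0 : 0 < k * e by rewrite mulr_gt0.
have d0 : 0 < d by exact: lt_le_trans ked.
have -> : 2 / k * (p ^+ 2 + 4 * p ^+ 2 * t1 ^+ 2 + L) * (e * tau)^-1 =
  2 / (n * (k * e)) * (p ^+ 2 * tau + 4 * p ^+ 2 * t1 ^+ 2 * tau + L * tau).
  by rewrite nE; field; rewrite !gt_eqF.
have t2 : t ^+ 2 <= t1 ^+ 2 by rewrite ler_sqr// nnegrE (le_trans t0).
have b1 : 32 * p ^+ 2 * n * t ^+ 2 / (8 * tau) <= 4 * p ^+ 2 * t1 ^+ 2 * tau.
  have -> : 32 * p ^+ 2 * n * t ^+ 2 / (8 * tau) = 4 * p ^+ 2 * t ^+ 2 * tau.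
    by rewrite nE; field; rewrite gt_eqF.
  by rewrite ler_pM2r// ler_wpM2l// mulr_ge0// sqr_ge0.
have b2 : l <= L * tau by rewrite (le_trans lL)// ler_peMr.
apply: (@le_trans _ _ (2 / (n * d) *
    (p ^+ 2 * tau + 4 * p ^+ 2 * t1 ^+ 2 * tau + L * tau))).
  by rewrite ler_pM2l ?divr_gt0 ?mulr_gt0// !lerD.
rewrite ler_wpM2r//; last first.
  by rewrite ler_pM2l// lef_pV2 ?posrE ?mulr_gt0// ler_pM2l.
have T0 := ltW tau0.
by rewrite !addr_ge0// mulr_ge0// ?sqr_ge0// mulr_ge0// ?sqr_ge0// mulr_ge0// sqr_ge0.
Qed.

(** [lam 1] squared is [|Sigma g|^2], at most the squared Frobenius norm [tr (Sigma^2)]; then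
    [x <= 1 + x^2]. *)
Lemma lam1_bounds (R : realType) (d : measure_display) (T : measurableType d)
    (P : probability T R) (n p q : nat) (X : 'M[R]_(n, q)) (Sigma : 'M[R]_p)
    (lam : nat -> R) (g : 'cV[R]_p) (E : T -> 'M[R]_(n, p)) :
  allometric_model P X Sigma lam g E ->
  0 <= lam 1%N <= 1 + \tr (Sigma *m Sigma).
Proof.
move=> model; have [Sg g1] := am_gamma1 model.
have gg : dotc g g = 1 by rewrite -enorm_sqr g1 expr1n.
have [Ssym _] := am_posdef model.
have l0 : 0 <= lam 1%N.
  by have := posdef_ge0 (am_posdef model) g; rewrite Sg dotcZr gg mulr1.
rewrite l0/=; have := dotc_mulmx_frobenius Sigma gg.
rewrite Sg dotcZl dotcZr gg mulr1.
have -> : \sum_j dotc (Sigma *m delta_mx j 0) (Sigma *m delta_mx j 0) = \tr (Sigma *m Sigma).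
  by apply: eq_bigr => j _; rewrite dotc_mulmxl Ssym mulmxA dotc_mulmx_delta.
by move: (\tr _) => s; nra.
Qed.

(** * Consistency in the regimes [alpha != 0] and [alpha = 0] *)

Unset Implicit Arguments.

Theorem theorem4p2 (R : realType) (p q : nat) (hp : (2 <= p)%N) (hq : (0 < q)%N)
  (alpha : 'cV[R]_q)
  (d : nat -> measure_display) (T : forall n, measurableType (d n))
  (P : forall n, probability (T n) R)
  (X : forall n, 'M[R]_(n, q)) (mu : nat -> 'cV[R]_p)
  (Sigma : nat -> 'M[R]_p) (lam : nat -> nat -> R) (gamma1 : nat -> 'cV[R]_p)
  (E : forall n, T n -> 'M[R]_(n, p))
  (hmodel : forall n, (1 + q < n)%N ->
    allometric_model (P n) (X n) (Sigma n) (lam n) (gamma1 n) (E n))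
  (ghat : forall n, T n -> 'cV[R]_p)
  (hghat : forall n, (1 + q < n)%N -> forall w : T n,
    first_principal_eigenvector
      (S_w (X n) (allometric_obs (X n) (mu n) alpha (gamma1 n) (E n w))
           (w_star (X n) alpha (Sigma n) (lam n)))
      (ghat n w))
  (hghat_meas : forall n, (1 + q < n)%N -> forall i : 'I_p,
    measurable_fun [set: T n] (fun w => ghat n w i 0))
  (hX : exists2 Q : 'M[R]_q, posdef Q &
    (fun n => n%:R^-1 *: ((X n)^T *m X n)) @ \oo --> Q)
  (htr : Theta_pow (fun n => \tr (Sigma n)) 0)
  (htr2 : Theta_pow (fun n => \tr (Sigma n *m Sigma n)) 0)
  (eta : R) (heta : 0 < eta)
  (hgap : Theta_pow (fun n => lam n 1%N - lam n 2%N) (- eta))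
  (halpha : alpha != 0 \/ eta < 1 / 2) :
  cvg_in_probability P
    (fun n w => Num.min (enorm (1 *: ghat n w - gamma1 n))
                        (enorm ((-1) *: ghat n w - gamma1 n))) 0.
Proof.
have [t1 t1p tr_le] := Theta_pow_le htr.
have [s0 s0p tr2_ge] := Theta_pow_ge htr2.
have [s1 s1p tr2_le] := Theta_pow_le htr2.
have [k kp gap_ge] := Theta_pow_ge hgap.
have [K Kp gap_le] := Theta_pow_le hgap.
pose tau (n : nat) : R := n%:R `^ 2^-1.
have tau_sqr n : n%:R = tau n ^+ 2.
  by rewrite -powR_mulrn ?powR_ge0// -powRrM mulVf// powRr1.
have tau_ge1 n : (0 < n)%N -> 1 <= tau n.
  by move=> n0; rewrite -(@ler_pXn2r _ 2) ?nnegrE ?powR_ge0// -tau_sqr expr1n ler1n.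
have tauV n : (tau n)^-1 = n%:R `^ (- 2^-1) by rewrite powRN.
have tr_bounds n : (1 + q < n)%N -> \tr (Sigma n) <= t1 * n%:R `^ 0 ->
    0 <= \tr (Sigma n) <= t1.
  move=> hn; rewrite powRr0 mulr1 => ->; rewrite andbT sumr_ge0// => i _.
  by rewrite -dotc_mulmx_delta (posdef_ge0 (am_posdef (hmodel n hn))).
have [a0|a0] := eqVneq alpha 0; last first.
  have [Q [Qsym Qpos] XQ] := hX.
  have cQ := cvg_dotc_mulmx (x := alpha) XQ.
  have Qa : 0 < dotc alpha (Q *m alpha) by rewrite /dotc mulmxA; exact: Qpos.
  (* Half the limit of [|X alpha|^2 / n], hence eventually a lower bound for it. *)
  pose kap := dotc alpha (Q *m alpha) / 2.
  have kap0 : 0 < kap by rewrite divr_gt0.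
  have c_ge : \forall n \near \oo, kap <= dotc alpha ((n%:R^-1 *: ((X n)^T *m X n)) *m alpha).
    apply: (cvgr_ge _ cQ); rewrite /kap; lra.
  (* The constant of [w_star_bounds], with [1 + s1 + t1] bounding [lam 1 + tr Sigma] and [K] coming
     from the gap. *)
  pose D := K * (q%:R / kap + 2 * (1 + s1 + t1) / s0).
  pose rate n := (4 * p%:R / kap + 4 * t1 + 2 * q%:R * t1 / kap) * n%:R `^ (- 2^-1) +
    4 * t1 * D / kap * n%:R `^ (- eta).
  have rate0 : rate @ \oo --> (0 : R).
    rewrite -[X in _ --> X](_ : (4 * p%:R / kap + 4 * t1 + 2 * q%:R * t1 / kap) * 0 +
      4 * t1 * D / kap * 0 = 0); last by rewrite !mulr0 addr0.
    by apply: cvgD; (apply: cvgM; [exact: cvg_cst|]); apply: cvg_powRN; rewrite ?invr_gt0.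
  have w_small : \forall n \near \oo, D * n%:R `^ (- eta) <= 2^-1.
    have : (fun n : nat => D * n%:R `^ (- eta)) @ \oo --> (0 : R).
      by rewrite -(mulr0 D); apply: cvgM; [exact: cvg_cst | exact: cvg_powRN heta].
    by move=> /cvgr_le; apply; rewrite invr_gt0.
  apply: (cvg_in_probability_rate rate0) => eps eps0; near=> n.
  have hn : (1 + q < n)%N by near: n; exact: nbhs_infty_gt.
  have n0 : (0 < n)%N by apply: leq_trans hn.
  have nR : 0 < n%:R :> R by rewrite ltr0n.
  have model := hmodel n hn.
  have trb : 0 <= \tr (Sigma n) <= t1 by apply: tr_bounds => //; near: n.
  have c_ge_n : kap * n%:R <= enorm (X n *m alpha) ^+ 2.
    have : kap <= dotc alpha ((n%:R^-1 *: ((X n)^T *m X n)) *m alpha) by near: n.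
    rewrite -scalemxAl dotcZr -mulmxA -dotc_mulmxl -enorm_sqr.
    by rewrite ler_pdivlMl// mulrC.
  have n1 : (1 : R) <= n%:R by rewrite ler1n.
  have kap_le : kap <= enorm (X n *m alpha) ^+ 2.
    by apply: le_trans c_ge_n; rewrite ler_peMr// ltW.
  have s0_le : s0 <= \tr (Sigma n *m Sigma n).
    have : s0 * n%:R `^ 0 <= \tr (Sigma n *m Sigma n) by near: n.
    by rewrite powRr0 mulr1.
  have s1_ge : \tr (Sigma n *m Sigma n) <= s1.
    have : \tr (Sigma n *m Sigma n) <= s1 * n%:R `^ 0 by near: n.
    by rewrite powRr0 mulr1.
  have /andP[l0 l1] := lam1_bounds model.
  have b_bounds : 0 <= lam n 1%N + \tr (Sigma n) <= 1 + s1 + t1.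
    by case/andP: trb => ? ?; apply/andP; split; lra.
  have d0 : 0 <= lam n 1%N - lam n 2%N by rewrite subr_ge0 ltW// (am_gap model).
  have /andP[w0 wle] := w_star_bounds kap0 kap_le s0p s0_le b_bounds d0.
  have wD : w_star (X n) alpha (Sigma n) (lam n) <= D * n%:R `^ (- eta).
    apply: le_trans wle _; rewrite /D [leRHS]mulrAC ler_wpM2r//.
      by rewrite addr_ge0 ?divr_ge0 ?mulr_ge0 ?(ltW kap0) ?(ltW s0p)//; lra.
    by near: n.
  have wb : 0 <= w_star (X n) alpha (Sigma n) (lam n) <= 2^-1.
    by rewrite w0 (le_trans wD)//; near: n.
  have tau0 : 0 < tau n by exact: lt_le_trans (tau_ge1 n n0).
  have c0 : 0 < enorm (X n *m alpha) ^+ 2 by exact: lt_le_trans kap_le.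
  apply: le_trans (error_prob_signal n0 model (hghat n hn) (hghat_meas n hn)
    eps0 tau0 wb erefl c0) _.
  rewrite lee_fin ler_pM2r ?invr_gt0 ?exprn_gt0// /rate -tauV.
  by apply: signal_rate => //; [exact: tau_ge1 | rewrite w0].
have eta2 : eta < 1 / 2 by case: halpha => //; rewrite a0 eqxx.
pose C := 2 / k * (p%:R ^+ 2 + 4 * p%:R ^+ 2 * t1 ^+ 2 + (1 + s1)).
(* The exponent is negative exactly because [eta < 1/2]. *)
pose rate n := C * n%:R `^ (- (2^-1 - eta)).
have rate0 : rate @ \oo --> (0 : R).
  rewrite -(mulr0 C); apply: cvgM; first exact: cvg_cst.
  by apply: cvg_powRN; lra.
apply: (cvg_in_probability_rate rate0) => eps eps0; near=> n.
have hn : (1 + q < n)%N by near: n; exact: nbhs_infty_gt.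
have n0 : (0 < n)%N by apply: leq_trans hn.
have nR : 0 < n%:R :> R by rewrite ltr0n.
have model := hmodel n hn.
have trb : 0 <= \tr (Sigma n) <= t1 by apply: tr_bounds => //; near: n.
have s0_le : s0 <= \tr (Sigma n *m Sigma n).
  have : s0 * n%:R `^ 0 <= \tr (Sigma n *m Sigma n) by near: n.
  by rewrite powRr0 mulr1.
have s1_ge : \tr (Sigma n *m Sigma n) <= s1.
  have : \tr (Sigma n *m Sigma n) <= s1 * n%:R `^ 0 by near: n.
  by rewrite powRr0 mulr1.
have /andP[l0 l1] := lam1_bounds model.
have d0 : 0 < lam n 1%N - lam n 2%N by rewrite subr_gt0 (am_gap model).
(* With [c = 0] the weight reduces to [a d q / (2 a d q)], whose denominator is nonzero. *)
have w2 : w_star (X n) alpha (Sigma n) (lam n) = 2^-1.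
  rewrite /w_star a0 mulmx0.
  have -> : enorm (0 : 'cV[R]_n) ^+ 2 = 0 by rewrite enorm_sqr /dotc mulmx0 mxE.
  rewrite !mulr0 !mul0r !addr0.
  have q0 : q%:R != 0 :> R by rewrite pnatr_eq0 -lt0n.
  have A0 : \tr (Sigma n *m Sigma n) + \tr (Sigma n) ^+ 2 != 0.
    by rewrite gt_eqF// ltr_pwDl ?sqr_ge0// (lt_le_trans s0p).
  by field; rewrite A0 q0 gt_eqF.
have tau0 : 0 < tau n by exact: lt_le_trans (tau_ge1 n n0).
apply: le_trans (error_prob_gap n0 hp model (hghat n hn) (hghat_meas n hn)
  eps0 tau0 w2 a0) _.
rewrite lee_fin ler_pM2r ?invr_gt0 ?exprn_gt0// /rate.
have -> : n%:R `^ (- (2^-1 - eta)) = (n%:R `^ (- eta) * tau n)^-1.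
  by rewrite -powRD ?(gt_eqF nR) ?implybT// -powRN; congr (_ `^ _); ring.
apply: gap_rate => //.
- exact: tau_ge1.
- exact: powR_gt0.
- by near: n.
- by lra.
- by lra.
Unshelve. all: by end_near. Qed.
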